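(* Let $K$ be an algebraically closed field with characteristic exponent $p$. Let $r$ be an even nonnegative integer and let $m\geq r$. Let $x$ be the generic skew-symmetric $m\times m$ matrix, with variables $x_{ij}$ for $i<j$, $x_{ji}=-x_{ij}$, $x_{ii}=0$, so that polynomials in $K[x_{ij}\mid 1\le i<j\le m]$ are functions on skew-symmetric matrices in $K^{m\times m}$. Then there is no nonzero polynomial vanishing on all skew-symmetric $m\times m$ matrices of rank $\leq r$ that has fewer than $(r+1)!!=(r+1)(r-1)\cdots 3\cdot 1$ terms. Furthermore, any polynomial with exactly $(r+1)!!$ terms that vanishes on all skew-symmetric $m\times m$ matrices of rank $r$ is of the form $c\,u\cdot P^{p^e}$, where $c\in K^*$, $u$ is a monomial, $e\in\mathbb{Z}_{\ge 0}$, and $P$ is the Pfaffian of some principal $(r+2)\times(r+2)$ submatrix of $x$.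
   Context: The characteristic exponent $p$ of $K$ is $1$ if $\operatorname{char}K=0$ and $\operatorname{char}K$ otherwise. The number of terms of a polynomial is the number of monomials with nonzero coefficient. A principal submatrix is one with the same set of row and column indices. *)

(* Defs.v *)
From mathcomp Require Import all_boot all_order all_algebra all_fingroup.
From mathcomp Require Import mpoly.
Set Implicit Arguments. Unset Strict Implicit. Unset Printing Implicit Defensive.
Import GRing.Theory.
Local Open Scope ring_scope.

Definition char_exp (K : nzRingType) (p : nat) : Prop :=
  (p \in [pchar K]) \/ (p = 1%N /\ forall q : nat, q \notin [pchar K]).

Fixpoint dfact (n : nat) : nat :=
  match n with
  | 0 => 1%N
  | 1 => 1%N
  | k.+2 => (k.+2 * dfact k)%N
  end.

(* The polynomial ring K[x_ij | i,j in 'I_m] is {mpoly K[m * m]}, variable x_ij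
   being 'X_(mxvec_index i j).  K[x_ij | i < j] is the subring of polynomials
   whose monomials only involve variables x_ij with i < j. *)
Definition upper_mpoly (K : nzRingType) (m : nat) (f : {mpoly K[m * m]}) : Prop :=
  forall u : 'X_{1..(m * m)}, u \in msupp f ->
  forall i j : 'I_m, ~~ (i < j)%N -> u (mxvec_index i j) = 0%N.

Definition nterms (K : nzRingType) (n : nat) (f : {mpoly K[n]}) : nat :=
  size (msupp f).

Definition alt_skew (K : nzRingType) (m : nat) (A : 'M[K]_m) : Prop :=
  A^T = - A /\ forall i, A i i = 0.

Definition eval_mx (K : comNzRingType) (m : nat) (f : {mpoly K[m * m]}) (A : 'M[K]_m) : K :=
  f.@[fun k => mxvec A 0 k].

Definition genx (K : nzRingType) (m : nat) (i j : 'I_m) : {mpoly K[m * m]} :=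
  if (i < j)%N then 'X_(mxvec_index i j)
  else if (j < i)%N then - 'X_(mxvec_index j i) else 0.

Lemma ev_lt (k : nat) (i : 'I_k) : (i.*2 < k.*2)%N.
Proof. by rewrite ltn_double. Qed.
Lemma od_lt (k : nat) (i : 'I_k) : (i.*2.+1 < k.*2)%N.
Proof. by rewrite -doubleS leq_double. Qed.
Definition ev (k : nat) (i : 'I_k) : 'I_(k.*2) := Ordinal (ev_lt i).
Definition od (k : nat) (i : 'I_k) : 'I_(k.*2) := Ordinal (od_lt i).

(* Pfaffian of a 2k x 2k matrix a, as a sum over perfect matchings encoded by
   permutations s with s(2i) < s(2i+1) and s(0) < s(2) < ... < s(2k-2). *)
Definition pf_perm (k : nat) (s : 'S_(k.*2)) : bool :=
  [forall i : 'I_k, (s (ev i) < s (od i))%N] &&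
  [forall i : 'I_k, forall j : 'I_k, (i < j)%N ==> (s (ev i) < s (ev j))%N].

Definition pfaffian (R : comNzRingType) (k : nat) (a : 'I_(k.*2) -> 'I_(k.*2) -> R) : R :=
  \sum_(s : 'S_(k.*2) | pf_perm s)
     (-1) ^+ s * \prod_(i < k) a (s (ev i)) (s (od i)).

Definition pf_sub (K : comNzRingType) (m k : nat) (g : 'I_(k.*2) -> 'I_m) : {mpoly K[m * m]} :=
  pfaffian (fun a b => genx K (g a) (g b)).

(* Main.v *)
Require Import Defs.
From mathcomp Require Import all_boot all_order all_algebra all_fingroup.
From mathcomp Require Import mpoly.
From Stdlib Require Import Classical.
From mathcomp Require Import zify ring.
Import GRing.Theory.
Local Open Scope ring_scope.
Set Implicit Arguments. Unset Strict Implicit. Unset Printing Implicit Defensive.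

(** Parametrize the skew-symmetric matrices of rank at most [r = 2h] as Gram matrices of the rows of an
    [m] by [2h] matrix [B] with respect to a symplectic form. Group the terms of [f] by their part in
    the variables of one row [o]. The coefficient of each row part vanishes in rank [r - 2], hence has
    at least [(r-1)!!] terms by induction; and for generic [B] the row [o] runs over a linear space of
    dimension [r] in general position, on which no nonzero polynomial with at most [r] terms vanishes.
    So there are at least [r + 1] row parts and [(r+1)!!] terms.

    If [f] has exactly [(r+1)!!] terms, divide it by its greatest common monomial. Specializations of
    [B] show that every row part is a power of one variable, so that each term is a power of the
    product over a perfect matching of the rows, and that the matchings are all those of a set of
    [r + 2] rows. Vanishing on four rows of a common plane reads
    [c1 (s + t)^q = c2 s^q + c3 t^q]; it forces [q] to be a power of the characteristic exponent
    and the signs to be those of the Pfaffian. *)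

(** * Polynomial functions and linear forms in general position *)

(** The induction over rows can stall: the coefficient of a row part may vanish in rank [r] itself,
    not only in rank [r - 2]. That coefficient then replaces [f], with one live row fewer. This is
    why polynomials carry a set [D] of dead rows and why the lower bound is a double induction.
    Equality in the count then makes every coefficient extremal, so the induction hypothesis
    describes each of them.

    Rank 0 is the awkward base: a single monomial need not determine the pair [W] or the power [q].
    The ambiguity is inherited by the step to rank 2, where [h = 0] needs separate arguments. *)

Section LinePoly.
Variables (K : closedFieldType) (V : lmodType K).

(** Being polynomial on every line suffices for density arguments, and it passes through sums,
    products and determinants without coordinates on [V]. *)
Definition linepoly (F : V -> K) : Prop :=
  forall x y, exists p : {poly K}, forall t, F (x + t *: y) = p.[t].

Lemma eq_lp (F G : V -> K) : F =1 G -> linepoly F -> linepoly G.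
Proof. by move=> e hF x y; have [p hp] := hF x y; exists p => t; rewrite -e. Qed.

Lemma lp_const a : linepoly (fun _ => a).
Proof. by move=> x y; exists a%:P => t; rewrite hornerC. Qed.

Lemma lp_lin (F : V -> K) :
  (forall x y t, F (x + t *: y) = F x + t * F y) -> linepoly F.
Proof.
move=> h x y; exists ((F x)%:P + (F y) *: 'X) => t.
by rewrite h !hornerE mulrC.
Qed.

Lemma lp_add F G : linepoly F -> linepoly G -> linepoly (fun x => F x + G x).
Proof.
move=> hF hG x y; have [p hp] := hF x y; have [q hq] := hG x y.
by exists (p + q) => t; rewrite hornerD hp hq.
Qed.

Lemma lp_mul F G : linepoly F -> linepoly G -> linepoly (fun x => F x * G x).
Proof.
move=> hF hG x y; have [p hp] := hF x y; have [q hq] := hG x y.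
by exists (p * q) => t; rewrite hornerM hp hq.
Qed.

Lemma lp_opp F : linepoly F -> linepoly (fun x => - F x).
Proof.
by move=> hF; apply: eq_lp (lp_mul (lp_const (-1)) hF) => x; rewrite mulN1r.
Qed.

Lemma lp_sub F G : linepoly F -> linepoly G -> linepoly (fun x => F x - G x).
Proof. by move=> hF hG; apply: lp_add => //; apply: lp_opp. Qed.

Lemma lp_exp F n : linepoly F -> linepoly (fun x => F x ^+ n).
Proof.
move=> hF; elim: n => [|n IH]; first by apply: lp_const.
by apply: eq_lp (lp_mul hF IH) => x; rewrite exprS.
Qed.

Lemma lp_sum (J : Type) (s : seq J) (P : pred J) (F : J -> V -> K) :
  (forall j, P j -> linepoly (F j)) -> linepoly (fun x => \sum_(j <- s | P j) F j x).
Proof.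
move=> hF; elim: s => [|j s IH].
  by apply: eq_lp (lp_const 0) => x; rewrite big_nil.
case Pj: (P j); last by apply: eq_lp IH => x; rewrite big_cons Pj.
by apply: eq_lp (lp_add (hF j Pj) IH) => x; rewrite big_cons Pj.
Qed.

Lemma lp_prod (J : Type) (s : seq J) (P : pred J) (F : J -> V -> K) :
  (forall j, P j -> linepoly (F j)) -> linepoly (fun x => \prod_(j <- s | P j) F j x).
Proof.
move=> hF; elim: s => [|j s IH].
  by apply: eq_lp (lp_const 1) => x; rewrite big_nil.
case Pj: (P j); last by apply: eq_lp IH => x; rewrite big_cons Pj.
by apply: eq_lp (lp_mul (hF j Pj) IH) => x; rewrite big_cons Pj.
Qed.

Lemma lp_det n (M : V -> 'M[K]_n) :
  (forall i j, linepoly (fun x => M x i j)) -> linepoly (fun x => \det (M x)).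
Proof.
move=> h; rewrite /determinant; apply: lp_sum => s _; apply: lp_mul.
  exact: lp_const.
by apply: lp_prod.
Qed.

Definition linear_set (L : V -> Prop) : Prop :=
  forall x y t, L x -> L y -> L (x + t *: y).

Lemma linear_setT : linear_set (fun _ => True). Proof. by []. Qed.

(** On the line joining the two witnesses, [F] is nonzero at [t = 0] and [G] at [t = 1]. The product
    of the two restrictions is a nonzero polynomial, and it has a nonroot because an algebraically
    closed field is infinite. *)
Lemma lp_gen2 (L : V -> Prop) (F G : V -> K) : linear_set L ->
  linepoly F -> linepoly G ->
  (exists2 x, L x & F x != 0) -> (exists2 x, L x & G x != 0) ->
  exists x, [/\ L x, F x != 0 & G x != 0].
Proof.
move=> HL hF hG [x Lx Fx] [y Ly Gy].
have Lyx : L (y - x) by rewrite -scaleN1r; apply: HL.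
have [p hp] := hF x (y - x); have [q hq] := hG x (y - x).
have p0 : p != 0.
  by apply: contraNneq Fx => p0; have := hp 0; rewrite scale0r addr0 p0 horner0 => ->.
have q0 : q != 0.
  apply: contraNneq Gy => q0; have := hq 1.
  by rewrite scale1r addrCA subrr addr0 q0 horner0 => ->.
have /closed_nonrootP[t] : p * q != 0 by rewrite mulf_neq0.
rewrite rootM negb_or /root -hp -hq => /andP[h1 h2].
by exists (x + t *: (y - x)); split=> //; apply: HL.
Qed.

Lemma lp_genall (J : eqType) (s : seq J) (L : V -> Prop) (F : J -> V -> K) :
  linear_set L -> (exists x, L x) ->
  (forall j, j \in s -> linepoly (F j)) ->
  (forall j, j \in s -> exists2 x, L x & F j x != 0) ->
  exists2 x, L x & forall j, j \in s -> F j x != 0.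
Proof.
move=> HL [x0 Lx0]; elim: s => [|j s IH] hF hx; first by exists x0.
have [||x Lx hxs] := IH; first by move=> k ks; apply: hF; rewrite inE ks orbT.
  by move=> k ks; apply: hx; rewrite inE ks orbT.
have [||||y [Ly]] := @lp_gen2 L (F j) (fun z => \prod_(k <- s) F k z) HL.
- by apply: hF; rewrite inE eqxx.
- elim: {IH hx hxs} s hF => [|k s IH] hF.
    by apply: eq_lp (lp_const 1) => z; rewrite big_nil.
  have hk : linepoly (F k) by apply: hF; rewrite !inE eqxx orbT.
  have hs : linepoly (fun z => \prod_(k <- s) F k z).
    apply: IH => l; rewrite inE => /orP[/eqP->|ls]; apply: hF; rewrite !inE ?eqxx //.
    by rewrite ls !orbT.
  by apply: eq_lp (lp_mul hk hs) => z; rewrite big_cons.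
- by apply: hx; rewrite inE eqxx.
- by exists x => //; rewrite prodf_seq_neq0; apply/allP => k ks; apply: hxs.
move=> Fj; rewrite prodf_seq_neq0 => /allP hs.
by exists y => // k; rewrite inE => /orP[/eqP->|/hs].
Qed.

(** Density of the set where [G] is nonzero; it justifies the later cancellations of factors that
    vanish at some points. *)
Lemma lp_zero (L : V -> Prop) (F G : V -> K) : linear_set L ->
  linepoly F -> linepoly G -> (exists2 x, L x & G x != 0) ->
  (forall x, L x -> G x != 0 -> F x = 0) -> forall x, L x -> F x = 0.
Proof.
move=> HL hF hG hx h x Lx; apply/eqP; apply: contraT => Fx.
have [|y [Ly Fy Gy]] := lp_gen2 HL hF hG _ hx; first by exists x.
by rewrite (h y Ly Gy) eqxx in Fy.
Qed.

End LinePoly.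

(** * Relations between monomials in linear forms *)

Section GeneralPosition.
Variables (K : closedFieldType) (V : lmodType K) (I : finType).
Variables (phi : I -> V -> K) (r : nat).
Hypothesis phi_lin : forall k x y t, phi k (x + t *: y) = phi k x + t * phi k y.
(** Equivalently, any at most [r] distinct forms of the family are linearly independent. *)
Hypothesis gp : forall (Z : {set I}) j, (#|Z| < r)%N -> j \notin Z ->
  exists b, (forall z, z \in Z -> phi z b = 0) /\ phi j b != 0.

Definition zeros_on (Z : {set I}) (b : V) : Prop := forall z, z \in Z -> phi z b = 0.

(** Forms indexed by [Z] are left out because they vanish on [zeros_on Z]; their powers have been
    divided out before restricting. *)
Definition formmon (Z : {set I}) (a : {ffun I -> nat}) (b : V) : K :=
  \prod_(k | k \notin Z) phi k b ^+ a k.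

Definition formrel (C : {ffun I -> nat} -> K) (Z : {set I}) (A : seq {ffun I -> nat}) :=
  forall b, zeros_on Z b -> \sum_(a <- A) C a * formmon Z a b = 0.

Implicit Types (Z : {set I}) (a : {ffun I -> nat}) (A : seq {ffun I -> nat}).
Implicit Types (C : {ffun I -> nat} -> K).

Lemma lp_phi k : linepoly (phi k).
Proof. by apply: lp_lin. Qed.

Lemma phi0 k : phi k 0 = 0.
Proof.
have := phi_lin k 0 0 1; rewrite scaler0 addr0 mul1r => h.
by apply: (addrI (phi k 0)); rewrite -h addr0.
Qed.

Lemma phiZ k t x : phi k (t *: x) = t * phi k x.
Proof. by have := phi_lin k 0 x t; rewrite add0r phi0 add0r. Qed.

Lemma zeros_on_linear Z : linear_set (zeros_on Z).
Proof. by move=> x y t hx hy z zZ; rewrite phi_lin hx // hy // mulr0 addr0. Qed.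

Lemma lp_formmon Z a : linepoly (formmon Z a).
Proof. by apply: lp_prod => k _; apply: lp_exp; apply: lp_phi. Qed.

Lemma formmonD1 Z a i b : i \notin Z ->
  formmon Z a b = phi i b ^+ a i * formmon (i |: Z) a b.
Proof.
move=> iZ; rewrite /formmon (bigD1 i) //=; congr (_ * _).
by apply: eq_bigl => k; rewrite !inE negb_or andbC.
Qed.

(** Divide the relation by the [e]-th power of form [i], which density on [zeros_on Z] permits, then
    restrict to the zeros of this form: only the terms with exponent exactly [e] survive. *)
Lemma formrel_step C Z A i e : (#|Z| < r)%N -> i \notin Z ->
  (forall a, a \in A -> (e <= a i)%N) -> formrel C Z A ->
  formrel C (i |: Z) [seq a : {ffun I -> nat} <- A | a i == e].
Proof.
move=> hZ iZ hA hrel b hb.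
pose G b := \sum_(a <- A) C a * (phi i b ^+ (a i - e) * formmon (i |: Z) a b).
have lpG : linepoly G.
  apply: lp_sum => a _; apply: lp_mul; first exact: lp_const.
  by apply: lp_mul; [apply/lp_exp/lp_phi | apply: lp_formmon].
have G0 : forall x, zeros_on Z x -> G x = 0.
  apply: (lp_zero (@zeros_on_linear Z) lpG (lp_phi i)).
    by have [x [h1 h2]] := gp hZ iZ; exists x.
  move=> x hx nz; apply: (mulfI (expf_neq0 e nz)); rewrite mulr0 -[RHS](hrel x hx).
  rewrite big_distrr /= !big_seq; apply: eq_bigr => a aA.
  rewrite (formmonD1 _ _ iZ) -{2}(subnKC (hA _ aA)) exprD.
  by rewrite mulrCA !mulrA.
have hbZ : zeros_on Z b by move=> z zZ; apply: hb; rewrite !inE zZ orbT.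
transitivity (G b); last exact: G0.
rewrite /G big_filter big_mkcond /= big_seq [RHS]big_seq.
apply: eq_bigr => a aA.
have -> : phi i b = 0 by apply: hb; rewrite !inE eqxx.
rewrite expr0n subn_eq0 eqn_leq (hA _ aA) andbT.
by case: ifP; rewrite ?mul1r // mul0r mulr0.
Qed.

Lemma forms_common_nonzero Z : (#|Z| < r)%N ->
  exists2 b, zeros_on Z b & forall k, k \notin Z -> phi k b != 0.
Proof.
move=> hZ; have [|||b hb h] := @lp_genall K V I (enum (~: Z)) (zeros_on Z) phi
   (@zeros_on_linear Z).
- by exists 0 => z _; apply: phi0.
- by move=> k _; apply: lp_phi.
- move=> k; rewrite mem_enum inE => kZ.
  by have [x [h1 h2]] := gp hZ kZ; exists x.
by exists b => // k kZ; apply: h; rewrite mem_enum inE.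
Qed.

(** Two terms differ in the exponent of some form [i]. Restricting to the zeros of that form adds
    one element to [Z] but loses at least one term, so the bound persists for the terms of minimal
    exponent. Once their coefficients vanish, the others satisfy a shorter relation on the same
    [Z]. *)
Lemma formrel_trivial C Z A : uniq A ->
  (forall a b, a \in A -> b \in A -> forall z, z \in Z -> a z = b z) ->
  (#|Z| + size A <= r)%N -> formrel C Z A -> forall a, a \in A -> C a = 0.
Proof.
have [n] := ubnP (size A); elim: n A Z => // n IH A Z szA uA agA szr hrel.
case: A szA uA agA szr hrel => [|a1 [|a2 A]] // szA uA agA szr hrel.
  have [|b hb nz] := @forms_common_nonzero Z; first by rewrite addn1 in szr.
  move=> a; rewrite inE => /eqP->; apply/eqP.
  have := hrel b hb; rewrite big_seq1 => /eqP; rewrite mulf_eq0.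
  suff /negPf-> : formmon Z a1 b != 0 by rewrite orbF.
  by apply/prodf_neq0 => k kZ; rewrite expf_neq0 // nz.
set B := _ :: _ in szA uA agA szr hrel *.
have /existsP[i a12] : [exists i, a1 i != a2 i].
  apply: contraT => /existsPn h; move: uA => /= /andP[]; rewrite inE.
  suff -> : a1 = a2 by rewrite eqxx.
  by apply/ffunP => i; apply/eqP; apply: contraT => /(negP (h i)).
have a1B : a1 \in B by rewrite !inE eqxx.
have a2B : a2 \in B by rewrite !inE eqxx orbT.
have iZ : i \notin Z by apply: contraNN a12 => iZ; rewrite (agA a1 a2).
have ex_e : exists e, has (fun a : {ffun I -> nat} => a i == e) B.
  by exists (a1 i); apply/hasP; exists a1.
case: (ex_minnP ex_e) => e /hasP[a0 a0B /eqP a0e] emin.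
have eB a : a \in B -> (e <= a i)%N by move=> aB; apply: emin; apply/hasP; exists a.
have szlt (p : pred {ffun I -> nat}) x : x \in B -> ~~ p x -> (size (filter p B) < size B)%N.
  move=> xB px; rewrite size_filter -(count_predC p B) -addn1 leq_add2l -has_count.
  by apply/hasP; exists x.
pose A0 := [seq a : {ffun I -> nat} <- B | a i == e]; pose A1 := [seq a : {ffun I -> nat} <- B | a i != e].
have szA0 : (size A0 < size B)%N.
  have /orP[h|h] : (a1 i != e) || (a2 i != e).
  - by rewrite -negb_and; apply: contraNN a12 => /andP[/eqP-> /eqP->].
  - exact: szlt h.
  - exact: szlt a2B h.
have szA1 : (size A1 < size B)%N by apply: (szlt _ a0) => //; rewrite a0e eqxx.
have hZ : (#|Z| < r)%N by apply: leq_trans szr; rewrite /B /= addnS ltnS leq_addr.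
have C0 a : a \in A0 -> C a = 0.
  apply: (IH A0 (i |: Z)).
  - by apply: leq_trans szA0 _; rewrite -ltnS.
  - exact: filter_uniq.
  - move=> x y; rewrite !mem_filter => /andP[/eqP xe xB] /andP[/eqP ye yB] z.
    by rewrite !inE => /orP[/eqP->|zZ]; [rewrite xe ye | apply: agA].
  - by rewrite cardsU1 iZ; lia.
  - exact: formrel_step.
have C1 a : a \in A1 -> C a = 0.
  apply: (IH A1 Z).
  - by apply: leq_trans szA1 _; rewrite -ltnS.
  - exact: filter_uniq.
  - by move=> x y; rewrite !mem_filter => /andP[_ xB] /andP[_ yB]; apply: agA.
  - by lia.
  - move=> b hb; transitivity (\sum_(x <- B) C x * formmon Z x b); last exact: hrel.
    rewrite big_filter [RHS](bigID (fun a : {ffun I -> nat} => a i != e)) /=.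
    rewrite [X in _ + X]big1_seq ?addr0 // => x /andP[xe xB].
    by rewrite C0 ?mul0r // mem_filter xB andbT -[_ == _]negbK.
move=> a aB; case ae: (a i == e); first by apply: C0; rewrite mem_filter ae.
by apply: C1; rewrite mem_filter ae.
Qed.

(* The next two lemmas describe the extremal case, with one term more than [formrel_trivial] allows. *)
Lemma formrel_coordinate C A i : uniq A -> (size A <= r.+1)%N -> (0 < r)%N ->
  formrel C set0 A -> (forall a, a \in A -> C a != 0) ->
  (exists2 a, a \in A & a i = 0%N) ->
  forall a b, a \in A -> b \in A -> a i != 0%N -> b i != 0%N -> a = b.
Proof.
move=> uA szA r0 hrel C0 [a0 a0A a0i] a b aA bA ai bi.
apply/eqP; apply: contraT => ab.
have : C a0 = 0; last by move/eqP; rewrite (negPf (C0 _ a0A)).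
(* On the zeros of form [i] both [a] and [b] drop out, so at most [r - 1] terms remain against the
   one condition imposed. *)
apply: (@formrel_trivial C (i |: set0) [seq x : {ffun I -> nat} <- A | x i == 0%N]).
- exact: filter_uniq.
- move=> x y; rewrite !mem_filter => /andP[/eqP xe _] /andP[/eqP ye _] z.
  by rewrite !inE orbF => /eqP->; rewrite xe ye.
- rewrite cardsU1 cards0 !inE /= addn0 add1n.
  apply: leq_trans (_ : (size A).-1 <= _)%N; last by lia.
  rewrite size_filter -(count_predC (fun x : {ffun I -> nat} => x i == 0%N) A).
  suff : (2 <= count (predC (fun x : {ffun I -> nat} => x i == 0%N)) A)%N by lia.
  rewrite -size_filter; apply: (@uniq_leq_size _ [:: a; b]).
    by rewrite /= inE ab.
  by move=> x; rewrite !inE mem_filter => /orP[]/eqP->; rewrite /= ?ai ?bi.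
- by apply: formrel_step; rewrite ?cards0 ?inE.
- by rewrite mem_filter a0i eqxx.
Qed.

Lemma formrel_degree C A : uniq A -> (size A <= r.+1)%N ->
  formrel C set0 A -> (forall a, a \in A -> C a != 0) ->
  forall a b, a \in A -> b \in A -> (\sum_k a k = \sum_k b k)%N.
Proof.
move=> uA szA hrel C0 a b aA bA; apply/eqP; apply: contraT => ab.
pose deg (x : {ffun I -> nat}) := (\sum_k x k)%N.
have : C a = 0; last by move/eqP; rewrite (negPf (C0 _ aA)).
apply: (@formrel_trivial C set0 [seq x : {ffun I -> nat} <- A | deg x == deg a]).
- exact: filter_uniq.
- by move=> x y _ _ z; rewrite inE.
- rewrite cards0 add0n size_filter -ltnS; apply: leq_trans szA.
  rewrite -(count_predC (fun x => deg x == deg a) A) -addn1 leq_add2l -has_count.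
  by apply/hasP; exists b => //=; rewrite eq_sym.
(* Evaluating at [t *: x] makes the relation a polynomial in [t], whose coefficient in degree
   [deg a] is the sum over the terms of that degree. *)
- move=> x _; pose P := \sum_(y <- A) (C y * formmon set0 y x) *: 'X^(deg y) : {poly K}.
  have hP t : P.[t] = 0.
    have h0 : zeros_on set0 (t *: x) by move=> z; rewrite inE.
    rewrite -[RHS](hrel _ h0) horner_sum; apply: eq_bigr => y _.
    have E z : formmon set0 y z = \prod_k phi k z ^+ y k.
      by apply: eq_bigl => k; rewrite inE.
    rewrite !hornerE !E -mulrA; congr (_ * _); rewrite mulrC -prodrXr -big_split /=.
    by apply: eq_bigr => k _; rewrite phiZ exprMn.
  have P0 : P = 0.
    apply/eqP; apply: contraT => /closed_nonrootP[t]; by rewrite /root hP eqxx.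
  transitivity (P`_(deg a)); last by rewrite P0 coef0.
  rewrite coef_sum big_filter big_mkcond /=; apply: eq_bigr => y _.
  by rewrite coefZ coefXn eq_sym; case: ifP; rewrite ?mulr1 ?mulr0.
- by rewrite mem_filter eqxx.
Qed.

End GeneralPosition.

(** * Gram matrices of symplectic vectors *)

Lemma index_eq (T : eqType) (s : seq T) x y : x \in s -> index x s = index y s -> x = y.
Proof.
move=> xs e; have ys : y \in s by rewrite -index_mem -e index_mem.
by rewrite -(nth_index x xs) e nth_index.
Qed.

Section Symplectic.
Variables (K : closedFieldType) (m : nat).

(* Row [i] of [B] is the vector [(P i, Q i)] of a symplectic space of dimension [2h]; [om B]
   is the Gram matrix of its rows, so it runs over the skew-symmetric matrices of rank at most [2h]. *)
Definition om h (B : 'M[K]_(m, h + h)) (i j : 'I_m) : K :=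
  \sum_(l < h) (B i (lshift h l) * B j (rshift h l) - B i (rshift h l) * B j (lshift h l)).

Definition oms h (B : 'M[K]_(m, h + h)) (i j : 'I_m) : K :=
  if (i < j)%N then om B i j else om B j i.

Definition mkPQ h (P Q : 'I_m -> 'I_h -> K) : 'M[K]_(m, h + h) :=
  \matrix_(i, c) match split c with inl l => P i l | inr l => Q i l end.

Lemma mkPQ_l h P Q i l : @mkPQ h P Q i (lshift h l) = P i l.
Proof. by rewrite mxE (unsplitK (inl l)). Qed.

Lemma mkPQ_r h P Q i l : @mkPQ h P Q i (rshift h l) = Q i l.
Proof. by rewrite mxE (unsplitK (inr l)). Qed.

Lemma om_mkPQ h P Q i j :
  om (@mkPQ h P Q) i j = \sum_(l < h) (P i l * Q j l - Q i l * P j l).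
Proof. by apply: eq_bigr => l _; rewrite !mkPQ_l !mkPQ_r. Qed.

Lemma om_anti h (B : 'M[K]_(m, h + h)) i j : om B i j = - om B j i.
Proof. by rewrite -sumrN; apply: eq_bigr => l _; rewrite opprB mulrC [X in _ - X]mulrC. Qed.

Lemma om_diag h (B : 'M[K]_(m, h + h)) i : om B i i = 0.
Proof. by rewrite /om big1 // => l _; rewrite mulrC subrr. Qed.

Definition setrow h (B : 'M[K]_(m, h + h)) (o : 'I_m) (b : 'rV[K]_(h + h)) : 'M[K]_(m, h + h) :=
  \matrix_(i, c) if i == o then b 0 c else B i c.

Lemma om_setrow h (B : 'M[K]_(m, h + h)) o b i j : i != o -> j != o ->
  om (setrow B o b) i j = om B i j.
Proof.
by move=> io jo; apply: eq_bigr => l _; rewrite !mxE (negPf io) (negPf jo).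
Qed.

(** The variable of rows [o] and [k] as a linear form in a new row [b]. The sign is there because
    for [k < o] this variable is the entry in row [k], not in row [o]. *)
Definition rowform h (B : 'M[K]_(m, h + h)) (o k : 'I_m) (b : 'rV[K]_(h + h)) : K :=
  (-1) ^+ (k < o)%N *
  \sum_(l < h) (b 0 (lshift h l) * B k (rshift h l) - b 0 (rshift h l) * B k (lshift h l)).

Lemma oms_setrow h (B : 'M[K]_(m, h + h)) o b k : k != o ->
  oms (setrow B o b) o k = rowform B o k b.
Proof.
move=> ko; rewrite /oms /rowform; case: ltngtP => [ok|ok|/val_inj ok].
- rewrite expr0 mul1r; apply: eq_bigr => l _.
  by rewrite !mxE eqxx (negPf ko).
- rewrite expr1 mulN1r om_anti; congr (- _); apply: eq_bigr => l _.
  by rewrite !mxE eqxx (negPf ko).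
- by rewrite ok eqxx in ko.
Qed.

Lemma rowform_lin h (B : 'M[K]_(m, h + h)) o k x y t :
  rowform B o k (x + t *: y) = rowform B o k x + t * rowform B o k y.
Proof.
rewrite /rowform mulrCA -mulrDr; congr (_ * _).
rewrite big_distrr -big_split; apply: eq_bigr => l _ /=; rewrite !mxE.
by ring.
Qed.

Lemma lp_entry m' n (i : 'I_m') (j : 'I_n) : linepoly (fun B : 'M[K]_(m', n) => B i j).
Proof. by apply: lp_lin => x y t; rewrite !mxE. Qed.

Lemma lp_om h i j : linepoly (fun B : 'M[K]_(m, h + h) => om B i j).
Proof.
apply: lp_sum => l _; apply: lp_sub; apply: lp_mul; exact: lp_entry.
Qed.

(** Any at most [h + h] rows are linearly independent, written in the form that [gp] asks for. *)
Definition generic_rows h (B : 'M[K]_(m, h + h)) : Prop :=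
  forall (Z : {set 'I_m}) j, (#|Z| < h + h)%N -> j \notin Z ->
  exists b : 'cV[K]_(h + h),
    (forall z, z \in Z -> (B *m b) z 0 = 0) /\ (B *m b) j 0 != 0.

(* Rows of [B] indexed by [s], completed by standard basis vectors to a square matrix. *)
Definition rows_on n (s : seq 'I_m) (B : 'M[K]_(m, n)) : 'M[K]_n :=
  \matrix_(k, l) if [pick i | (k < size s)%N && (index i s == k)] is Some i then B i l
                 else (k == l)%:R.

Lemma lp_det_rows_on n s : linepoly (fun B : 'M[K]_(m, n) => \det (rows_on s B)).
Proof.
apply: lp_det => i j; case: (pickP (fun x => (i < size s)%N && (index x s == i))) => [x hx|hx].
  move: hx => /andP[h1 /eqP h2]; apply: eq_lp (lp_entry x j) => B; rewrite mxE.
  case: pickP => [y /andP[_ /eqP hy]|/(_ x)]; last by rewrite h1 h2 eqxx.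
  by congr (B _ _); apply: (@index_eq _ s); rewrite ?h2 // -index_mem h2.
apply: eq_lp (lp_const _) => B; rewrite mxE; case: pickP => [y|_]; last reflexivity.
by rewrite hx.
Qed.

Lemma det_rows_on_neq0 n s : uniq s -> (size s <= n)%N ->
  exists B : 'M[K]_(m, n), \det (rows_on s B) != 0.
Proof.
move=> us ss; exists (\matrix_(i, l) (index i s == l)%:R).
suff -> : rows_on s (\matrix_(i, l) (index i s == l :> nat)%:R) = 1%:M :> 'M[K]_n.
  by rewrite det1 oner_neq0.
apply/matrixP => k l; rewrite !mxE; case: pickP => [i /andP[_ /eqP hi]|//].
by rewrite mxE hi.
Qed.

(** Solve for the first unit vector: row [j] heads the list, so it pairs to 1 with the solution, and
    the rows of [Z] pair to 0. *)
Lemma rows_on_vector n (Z : {set 'I_m}) j (B : 'M[K]_(m, n)) : (#|Z| < n)%N -> j \notin Z ->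
  \det (rows_on (j :: enum Z) B) != 0 ->
  exists b : 'cV[K]_n, (forall z, z \in Z -> (B *m b) z 0 = 0) /\ (B *m b) j 0 != 0.
Proof.
case: n B => // n B hZ jZ.
set s := j :: enum Z; set M := rows_on s B => hdet.
have uM : M \in unitmx by rewrite unitmxE unitfE.
pose b := invmx M *m delta_mx 0 0 : 'cV[K]_n.+1.
have szs : size s = #|Z|.+1 by rewrite /= -cardE.
have hM i : i \in s -> (B *m b) i 0 = (index i s == 0%N)%:R.
  move=> si; have hi : (index i s < n.+1)%N.
    by apply: leq_trans hZ; rewrite -szs index_mem.
  have -> : (B *m b) i 0 = (M *m b) (Ordinal hi) 0.
    rewrite !mxE; apply: eq_bigr => l _; congr (_ * _); rewrite mxE /=.
    case: pickP => [y /andP[_ /eqP hy]|/(_ i)]; last first.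
      by move=> /negP[]; apply/andP; split; [rewrite -index_mem in si | apply/eqP].
    by congr (B _ _); apply: (@index_eq _ s).
  by rewrite mulmxA mulmxV // mul1mx mxE andbT.
exists b; split=> [z zZ|]; last by rewrite hM ?mem_head //= eqxx oner_neq0.
rewrite hM /=; last by rewrite inE mem_enum zZ orbT.
have /negPf-> : j != z by apply: contraNneq jZ => ->.
by [].
Qed.

Lemma generic_rows_exist h (F : 'M[K]_(m, h + h) -> K) : linepoly F ->
  (exists B, F B != 0) -> exists2 B, generic_rows B & F B != 0.
Proof.
move=> lpF [B0 FB0].
pose J := [seq x : {set 'I_m} * 'I_m <- enum {: {set 'I_m} * 'I_m} | (#|x.1| < h + h)%N && (x.2 \notin x.1)].
have [|||B _ hB] := @lp_genall K 'M[K]_(m, h + h) _ J (fun _ => True)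
  (fun x B => \det (rows_on (x.2 :: enum x.1) B)) (@linear_setT _ _).
- by exists 0.
- by move=> x _; apply: lp_det_rows_on.
- move=> x; rewrite mem_filter => /andP[/andP[h1 h2] _].
  have [||B hB] := @det_rows_on_neq0 (h + h) (x.2 :: enum x.1); last by exists B.
    by rewrite /= mem_enum h2 enum_uniq.
  by rewrite /= -cardE.
pose G (B : 'M[K]_(m, h + h)) := \prod_(x <- J) \det (rows_on (x.2 :: enum x.1) B).
have [|||B1 [_ F1 G1]] := @lp_gen2 K 'M[K]_(m, h + h) (fun _ => True) F G (@linear_setT _ _) lpF.
- by apply: lp_prod => x _; apply: lp_det_rows_on.
- by exists B0.
- by exists B => //; rewrite prodf_seq_neq0; apply/allP => x xJ; apply: hB.
exists B1 => // Z j hZ jZ; apply: rows_on_vector => //.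
move: G1; rewrite prodf_seq_neq0 => /allP /(_ (Z, j)); apply.
by rewrite mem_filter /= hZ jZ mem_enum.
Qed.

Lemma rowform_general_position h (B : 'M[K]_(m, h + h)) o : generic_rows B ->
  forall (Z : {set 'I_m}) j, (#|Z| < h + h)%N -> j \notin Z ->
  exists b, (forall z, z \in Z -> rowform B o z b = 0) /\ rowform B o j b != 0.
Proof.
move=> gB Z j hZ jZ; have [b [b0 bj]] := gB Z j hZ jZ.
(* Exchanging the halves of [b] with a sign turns the ordinary product with a row into the
   symplectic one. *)
pose b' := \row_(c < h + h) match split c with
   inl l => b (rshift h l) 0 | inr l => - b (lshift h l) 0 end.
have E k : rowform B o k b' = (-1) ^+ (k < o)%N * (B *m b) k 0.
  congr (_ * _); rewrite mxE big_split_ord /= addrC -big_split; apply: eq_bigr => l _ /=.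
  rewrite !mxE (unsplitK (inl l)) (unsplitK (inr l)) mulNr opprK.
  by rewrite mulrC [X in _ + X]mulrC.
exists b'; split=> [z zZ|]; first by rewrite E b0 // mulr0.
by rewrite E mulf_neq0 // signr_eq0.
Qed.

End Symplectic.

(** * Sparse polynomials in the entries of a skew-symmetric matrix *)

Local Arguments dfact : simpl never.

Lemma big_partition_undup (R : nmodType) (T A : eqType) (s : seq T) (f : T -> A) (F : T -> R) :
  \sum_(u <- s) F u = \sum_(a <- undup (map f s)) \sum_(u <- s | f u == a) F u.
Proof.
rewrite (exchange_big_dep xpredT) //= big_seq [RHS]big_seq; apply: eq_bigr => u us.
rewrite (eq_bigl (fun a => a == f u)); last by move=> a; rewrite eq_sym.
by rewrite -big_filter filter_pred1_uniq ?undup_uniq ?mem_undup ?map_f // big_seq1.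
Qed.

Lemma uniq_all_eq (T : eqType) (s : seq T) x :
  uniq s -> x \in s -> {in s, forall y, y = x} -> s = [:: x].
Proof.
move=> us xs h; apply: perm_small_eq => //; apply: uniq_perm => // y.
by rewrite inE; apply/idP/eqP => [/h|->].
Qed.

Section Sparse.
Variables (K : closedFieldType) (m : nat) (T : eqType).
Notation I := 'I_m.
Implicit Types (ex : T -> I -> I -> nat) (c : T -> K) (S : seq T) (D : {set I}).

(* A polynomial in the entries of a skew-symmetric matrix is a list [S] of labels, with
   coefficients [c u] and symmetric exponents [ex u]. The rows in [D] are dead: their entries are
   replaced by 1, which is harmless when all terms have the same exponents there. *)
Definition mon (e : I -> I -> nat) D h (B : 'M[K]_(m, h + h)) : K :=
  \prod_(i | i \notin D) \prod_(j | (j \notin D) && (i < j)%N) om B i j ^+ e i j.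

Definition pe ex c S D h (B : 'M[K]_(m, h + h)) : K :=
  \sum_(u <- S) c u * mon (ex u) D B.

Definition vanish h ex c S D : Prop := forall B : 'M[K]_(m, h + h), pe ex c S D B = 0.

Record wf ex c S D : Prop := Wf {
  wf_uniq : uniq S;
  wf_inj : {in S &, forall u v, (forall i j, ex u i j = ex v i j) -> u = v};
  wf_c : {in S, forall u, c u != 0};
  wf_sym : forall u i j, ex u i j = ex u j i;
  wf_diag : forall u i, ex u i i = 0%N;
  wf_agree : {in S &, forall u v, forall i j, i \in D -> ex u i j = ex v i j} }.

(** Dead columns are zeroed: by [wf_agree] their exponents are constant on [S], so nothing is lost
    and the row part involves live variables only. *)
Definition rw ex D (o : I) (u : T) : {ffun I -> nat} :=
  [ffun k => if k \in o |: D then 0%N else ex u o k].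

Definition cls ex D o S (a : {ffun I -> nat}) : seq T := [seq u <- S | rw ex D o u == a].

Definition rws ex D o S : seq {ffun I -> nat} := undup (map (rw ex D o) S).

Lemma lp_mon e D h : linepoly (fun B : 'M[K]_(m, h + h) => mon e D B).
Proof.
apply: lp_prod => i _; apply: lp_prod => j _; apply: lp_exp; exact: lp_om.
Qed.

Lemma lp_pe ex c S D h : linepoly (fun B : 'M[K]_(m, h + h) => pe ex c S D B).
Proof. by apply: lp_sum => u _; apply: lp_mul; [apply: lp_const | apply: lp_mon]. Qed.

Lemma mon_neq0 e D h (B : 'M[K]_(m, h + h)) :
  (forall i j, i \notin D -> j \notin D -> (i < j)%N -> (0 < e i j)%N -> om B i j != 0) ->
  mon e D B != 0.
Proof.
move=> H; apply/prodf_neq0 => i iD; apply/prodf_neq0 => j /andP[jD ij].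
by case e0: (e i j) => [|n]; rewrite ?expr0 ?oner_neq0 // expf_neq0 // H // e0.
Qed.

Lemma mon_eq0 e D h (B : 'M[K]_(m, h + h)) i j : i \notin D -> j \notin D -> i != j ->
  (forall x y, e x y = e y x) -> (0 < e i j)%N -> om B i j = 0 -> mon e D B = 0.
Proof.
move=> iD jD ij esym e0 o0.
wlog lij : i j iD jD ij e0 o0 / (i < j)%N.
  move=> H; case: (ltngtP i j) ij => [lij|lij|/val_inj->]; rewrite ?eqxx // => ij.
    exact: (H i j).
  by apply: (H j i); rewrite // 1?eq_sym // ?[e j i]esym // om_anti o0 oppr0.
apply/eqP; rewrite prodf_seq_eq0; apply/hasP; exists i; first by rewrite mem_index_enum.
rewrite iD /= prodf_seq_eq0; apply/hasP; exists j; first by rewrite mem_index_enum.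
by rewrite jD lij o0 expr0n; case: (e i j) e0 => // n _; rewrite eqxx.
Qed.

Lemma mon_ext e e' D h (B : 'M[K]_(m, h + h)) :
  (forall i j, i \notin D -> j \notin D -> e i j = e' i j) -> mon e D B = mon e' D B.
Proof.
by move=> H; apply: eq_bigr => i iD; apply: eq_bigr => j /andP[jD _]; rewrite H.
Qed.

Lemma monD e e' D h (B : 'M[K]_(m, h + h)) :
  mon (fun i j => e i j + e' i j)%N D B = mon e D B * mon e' D B.
Proof.
rewrite -big_split; apply: eq_bigr => i _ /=; rewrite -big_split; apply: eq_bigr => j _ /=.
by rewrite exprD.
Qed.

Lemma mon_row e D o h (B : 'M[K]_(m, h + h)) : o \notin D -> (forall i j, e i j = e j i) ->
  mon e D B = mon e (o |: D) B * \prod_(k | k \notin o |: D) oms B o k ^+ e o k.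
Proof.
move=> oD esym; pose G i j := om B i j ^+ e i j.
rewrite /mon (bigD1 o) //= -/(G o).
have E i : (i \notin D) && (i != o) = (i \notin o |: D).
  by rewrite !inE negb_or andbC.
rewrite (eq_bigl _ _ E).
have -> : \prod_(i | i \notin o |: D) \prod_(j | (j \notin D) && (i < j)%N) om B i j ^+ e i j
   = \prod_(i | i \notin o |: D) ((if (i < o)%N then G i o else 1) *
       \prod_(j | (j \notin o |: D) && (i < j)%N) om B i j ^+ e i j).
  apply: eq_bigr => i iD; case: ifP => io.
    rewrite (bigD1 o) ?oD //=; congr (_ * _); apply: eq_bigl => j.
    by rewrite -E -!andbA; congr (_ && _); rewrite andbC.
  rewrite mul1r; apply: eq_bigl => j; rewrite -E -andbA; case: eqP => [->|//].
  by rewrite io !andbF.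
rewrite big_split /= mulrA mulrC; congr (_ * _).
rewrite (eq_bigl (fun j => (j \notin o |: D) && (o < j)%N)); last first.
  by move=> j; rewrite -E -andbA; case: eqP => [->|//]; rewrite ltnn andbF.
rewrite big_mkcondr -big_split; apply: eq_bigr => k kD /=; rewrite /oms /G.
case: ltngtP => [_|_|/val_inj ok]; rewrite ?mulr1 ?mul1r 1?esym //.
by rewrite ok !inE eqxx in kD.
Qed.

Lemma rw_dead ex D o u k : k \in o |: D -> rw ex D o u k = 0%N.
Proof. by move=> h; rewrite ffunE h. Qed.

Lemma mem_rws ex D o S u : u \in S -> rw ex D o u \in rws ex D o S.
Proof. by move=> uS; rewrite mem_undup map_f. Qed.

Lemma rwsP ex D o S a : a \in rws ex D o S -> exists2 u, u \in S & a = rw ex D o u.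
Proof. by rewrite mem_undup => /mapP. Qed.

Lemma mem_cls ex D o S a u : (u \in cls ex D o S a) = (u \in S) && (rw ex D o u == a).
Proof. by rewrite mem_filter andbC. Qed.

Lemma size_cls ex D o S : size S = (\sum_(a <- rws ex D o S) size (cls ex D o S a))%N.
Proof.
rewrite -sum1_size (big_partition_undup _ (rw ex D o)); apply: eq_bigr => a _.
by rewrite size_filter -sum1_count.
Qed.

Lemma row_expand ex c S D o h (B : 'M[K]_(m, h + h)) : wf ex c S D -> o \notin D ->
  pe ex c S D B = \sum_(a <- rws ex D o S)
     pe ex c (cls ex D o S a) (o |: D) B * \prod_k oms B o k ^+ a k.
Proof.
move=> W oD; rewrite /pe (big_partition_undup _ (rw ex D o)); apply: eq_bigr => a _.
rewrite big_filter big_distrl /=; apply: eq_bigr => u /eqP <-.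
rewrite (@mon_row _ _ o) //; last exact: (wf_sym W).
rewrite -mulrA; congr (_ * (_ * _)); rewrite big_mkcond; apply: eq_bigr => k _.
by rewrite ffunE; case: (k \in _).
Qed.

Lemma wf_filter ex c S D (p : pred T) : wf ex c S D -> wf ex c (filter p S) D.
Proof.
case=> h1 h2 h3 h4 h5 h6; split => //.
- exact: filter_uniq.
- by move=> u v; rewrite !mem_filter => /andP[_ uS] /andP[_ vS]; apply: h2.
- by move=> u; rewrite mem_filter => /andP[_]; apply: h3.
- by move=> u v; rewrite !mem_filter => /andP[_ uS] /andP[_ vS]; apply: h6.
Qed.

Lemma rw_eq ex c S D o u v : wf ex c S D -> u \in S -> v \in S -> rw ex D o u = rw ex D o v ->
  forall j, ex u o j = ex v o j.
Proof.
move=> W uS vS E j; have /ffunP/(_ j) := E; rewrite !ffunE in_setU1.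
case: eqP => [-> _|_ /=]; first by rewrite !(wf_diag W).
case: ifP => // jD _; rewrite (wf_sym W) [RHS](wf_sym W); exact: (wf_agree W).
Qed.

Lemma wf_cls ex c S D o a : wf ex c S D -> wf ex c (cls ex D o S a) (o |: D).
Proof.
move=> W; have [h1 h2 h3 h4 h5 h6] := wf_filter (fun u => rw ex D o u == a) W.
split=> // u v; rewrite !mem_cls => /andP[uS /eqP ua] /andP[vS /eqP va] i j.
rewrite !inE => /orP[/eqP->|iD]; last exact: (wf_agree W).
by apply: (rw_eq W) => //; rewrite ua va.
Qed.

Lemma formmon_all k' (V : lmodType K) (phi : I -> V -> K) (a : {ffun I -> nat}) (b : V) :
  k' = set0 -> formmon phi k' a b = \prod_k phi k b ^+ a k.
Proof. by move=> ->; apply: eq_bigl => k; rewrite inE. Qed.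

Lemma row_relation ex c S D o h (B : 'M[K]_(m, h + h)) : wf ex c S D -> o \notin D ->
  vanish h ex c S D ->
  formrel (rowform B o) (fun a => pe ex c (cls ex D o S a) (o |: D) B) set0 (rws ex D o S).
Proof.
move=> W oD hv b _; rewrite -[RHS](hv (setrow B o b)) (row_expand _ W oD).
rewrite big_seq [RHS]big_seq; apply: eq_bigr => a /rwsP[u uS ->].
rewrite formmon_all //; congr (_ * _).
  apply: eq_bigr => v _; congr (_ * _); apply: eq_bigr => i; rewrite !inE negb_or => /andP[io _].
  apply: eq_bigr => j; rewrite !inE negb_or => /andP[/andP[jo _] _].
  by rewrite om_setrow.
apply: eq_bigr => k _; case: (eqVneq k o) => [->|ko].
  by rewrite rw_dead ?inE ?eqxx // !expr0.
by rewrite oms_setrow.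
Qed.

(* Deleting row [o] lowers the rank: on a hyperbolic plane orthogonal to the other coordinates,
   row [o] of the Gram matrix can be prescribed arbitrarily. *)
Lemma cls_vanish ex c S D o h a : wf ex c S D -> o \notin D ->
  vanish h.+1 ex c S D -> a \in rws ex D o S -> vanish h ex c (cls ex D o S a) (o |: D).
Proof.
move=> W oD hv aA B.
pose phi (k : I) (x : 'rV[K]_m) := (-1) ^+ (k < o)%N * x 0 k.
have phi_lin k x y t : phi k (x + t *: y) = phi k x + t * phi k y.
  by rewrite /phi !mxE; ring.
(* Coordinates satisfy general position for every bound, so the bound can be the number of
   classes. *)
pose r := (size (rws ex D o S)).
have gp (Z : {set I}) j : (#|Z| < r)%N -> j \notin Z ->
    exists b, (forall z, z \in Z -> phi z b = 0) /\ phi j b != 0.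
  move=> _ jZ; exists (delta_mx 0 j); rewrite /phi; split=> [z zZ|].
    by rewrite mxE eqxx (_ : z == j = false) ?mulr0 //; apply: contraNF jZ => /eqP<-.
  by rewrite mxE !eqxx mulr1 signr_eq0.
apply: (formrel_trivial phi_lin gp (C := fun a => pe ex c (cls ex D o S a) (o |: D) B)
   (Z := set0) (A := rws ex D o S)) aA; rewrite ?undup_uniq ?cards0 //.
  by move=> ? ? _ _ z; rewrite inE.
move=> x _.
(* Plane [ord0] is the extra one: row [o] is its first basis vector and is zero elsewhere, and row
   [i] has component [x 0 i] along the second. *)
pose P i (l : 'I_h.+1) := if unlift ord0 l is Some l' then
   (if i == o then 0 else B i (lshift h l')) else (i == o)%:R.
pose Q i (l : 'I_h.+1) := if unlift ord0 l is Some l' then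
   (if i == o then 0 else B i (rshift h l')) else (if i == o then 0 else x 0 i).
have omE i j : i != o -> j != o -> om (mkPQ P Q) i j = om B i j.
  move=> io jo; rewrite om_mkPQ big_ord_recl /P /Q unlift_none (negPf io) (negPf jo).
  by rewrite mul0r mulr0 subrr add0r; apply: eq_bigr => l _; rewrite liftK.
have omoE k : k != o -> om (mkPQ P Q) o k = x 0 k.
  move=> ko; rewrite om_mkPQ big_ord_recl /P /Q unlift_none eqxx (negPf ko) mul1r mul0r subr0.
  by rewrite big1 ?addr0 // => l _; rewrite liftK !mul0r subrr.
rewrite -[RHS](hv (mkPQ P Q)) (row_expand _ W oD).
rewrite big_seq [RHS]big_seq; apply: eq_bigr => a' /rwsP[u uS ->].
rewrite formmon_all //; congr (_ * _).
  apply: eq_bigr => v _; congr (_ * _); apply: eq_bigr => i; rewrite !inE negb_or => /andP[io _].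
  apply: eq_bigr => j; rewrite !inE negb_or => /andP[/andP[jo _] _].
  by rewrite omE.
apply: eq_bigr => k _; case: (eqVneq k o) => [->|ko].
  by rewrite rw_dead ?inE ?eqxx // !expr0.
rewrite /phi /oms; case: ltngtP => [ok|ok|/val_inj ok]; last by rewrite ok eqxx in ko.
  by rewrite expr1 mulN1r om_anti omoE.
by rewrite expr0 mul1r omoE.
Qed.

Lemma generic_classes ex c S D o h : 
  {in rws ex D o S, forall a, ~ vanish h ex c (cls ex D o S a) (o |: D)} ->
  exists2 B : 'M[K]_(m, h + h), generic_rows B &
    {in rws ex D o S, forall a, pe ex c (cls ex D o S a) (o |: D) B != 0}.
Proof.
move=> H; have [|||B _ hB] := @lp_genall K 'M[K]_(m, h + h) _ (rws ex D o S) (fun _ => True)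
  (fun a B => pe ex c (cls ex D o S a) (o |: D) B) (@linear_setT K _).
- by exists 0.
- by move=> a _; apply: lp_pe.
- move=> a aA; have /not_all_ex_not[B hB] := H a aA.
  by exists B => //; apply/eqP.
have [||B' h1 h2] := @generic_rows_exist K m h
   (fun B => \prod_(a <- rws ex D o S) pe ex c (cls ex D o S a) (o |: D) B).
- by apply: lp_prod => a _; apply: lp_pe.
- by exists B; rewrite prodf_seq_neq0; apply/allP => a aA; apply: hB.
by exists B' => // a aA; move: h2; rewrite prodf_seq_neq0 => /allP/(_ _ aA).
Qed.

Lemma many_classes ex c S D o h : wf ex c S D -> o \notin D -> S != [::] ->
  vanish h ex c S D ->
  {in rws ex D o S, forall a, ~ vanish h ex c (cls ex D o S a) (o |: D)} ->
  (h + h < size (rws ex D o S))%N.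
Proof.
move=> W oD S0 hv H; rewrite ltnNge; apply/negP => sz.
have [B gB nz] := generic_classes H.
case: S S0 W hv H sz nz => // u S _ W hv H sz nz.
have uA : rw ex D o u \in rws ex D o (u :: S) by rewrite mem_rws ?mem_head.
have := nz _ uA; suff -> : pe ex c (cls ex D o (u :: S) (rw ex D o u)) (o |: D) B = 0.
  by rewrite eqxx.
have := formrel_trivial (@rowform_lin K m h B o) (rowform_general_position o gB)
  _ _ _ (@row_relation _ _ _ _ _ _ B W oD hv); apply => //; rewrite ?undup_uniq ?cards0 //.
by move=> ? ? _ _ z; rewrite inE.
Qed.

Lemma dfact_step h : dfact (h.+1.*2.+1) = ((h.+1 + h.+1).+1 * dfact (h.*2.+1))%N.
Proof. by rewrite doubleS addnn doubleS. Qed.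

(** Induction on [h], then on the number of live rows. If some class still vanishes in the same
    rank, it has fewer live rows. Otherwise there are at least [(h.+1 + h.+1).+1] classes, each
    bounded below in lower rank. With no live row left, [wf] reduces [S] to one nonzero constant,
    which cannot vanish. *)
Lemma nterms_lower_bound h ex c S D : wf ex c S D -> S != [::] -> vanish h ex c S D ->
  (dfact (h.*2.+1) <= size S)%N.
Proof.
elim: h ex c S D => [|h IH] ex c S D; first by move=> _; case: S.
have [n] := ubnP #|~: D|; elim: n S D => // n IHn S D hn W S0 hv.
case: (pickP [pred o | o \notin D]) => [o /= oD|allD]; last first.
  case: S S0 W hv => // u S _ W /(_ 0).
  rewrite (uniq_all_eq (wf_uniq W) (mem_head _ _)) /pe ?big_seq1.
    rewrite /mon big_pred0; last by move=> i; apply: allD.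
    by rewrite mulr1 => /eqP; rewrite (negPf (wf_c W (mem_head _ _))).
  move=> v vS; apply: (wf_inj W) => // [|i j]; first exact: mem_head.
  by apply: (wf_agree W) => //; [exact: mem_head | have /negbFE := allD i].
have clsN a : a \in rws ex D o S -> cls ex D o S a != [::].
  move=> /rwsP[u uS ->]; apply/eqP => E; suff: u \in [::] by [].
  by rewrite -E mem_cls uS eqxx.
have [[a [aA av]]|H] :=
  classic (exists a, a \in rws ex D o S /\ vanish h.+1 ex c (cls ex D o S a) (o |: D)).
  apply: leq_trans (_ : size (cls ex D o S a) <= _)%N; last by rewrite size_filter count_size.
  apply: (IHn _ (o |: D)) => //; last exact: clsN.
    have E : ~: (o |: D) = (~: D) :\ o by apply/setP => k; rewrite !inE negb_or.
    by move: hn; rewrite ltnS E (cardsD1 o (~: D)) inE oD add1n.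
  exact: wf_cls.
have H' : {in rws ex D o S, forall a, ~ vanish h.+1 ex c (cls ex D o S a) (o |: D)}.
  by move=> a aA av; apply: H; exists a.
have sz := many_classes W oD S0 hv H'.
rewrite dfact_step (size_cls ex D o S).
apply: leq_trans (_ : size (rws ex D o S) * dfact (h.*2.+1) <= _)%N.
  by rewrite leq_mul2r sz orbT.
rewrite mulnC -[X in (X <= _)%N]iter_addn_0 -[X in iter X _ _](count_predT (rws ex D o S)).
rewrite -big_const_seq big_seq [X in (_ <= X)%N]big_seq; apply: leq_sum => a aA.
apply: IH; first exact: wf_cls W.
  exact: clsN.
exact: cls_vanish hv aA.
Qed.

End Sparse.

(** * Perfect matchings *)

(** Exchanges [2i] and [2i+1], so that a list of even length encodes a perfect matching of its
    entries. *)
Definition partner (n : nat) : nat := if odd n then n.-1 else n.+1.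

Lemma partnerK : involutive partner.
Proof. by move=> n; rewrite /partner; case: n => [|n] //=; case E: (odd n); rewrite /= E. Qed.

Lemma partner_neq n : partner n != n.
Proof. by rewrite /partner; case: n => [|n] //=; case: (odd n) => /=; lia. Qed.

Lemma partner_lt n h : (n < h.*2)%N -> (partner n < h.*2)%N.
Proof.
by rewrite /partner; case: ifP => odn; lia.
Qed.

Section Matchings.
Variables (K : closedFieldType) (m : nat) (T : eqType).
Notation I := 'I_m.
Implicit Types (ex : T -> I -> I -> nat) (c : T -> K) (S : seq T) (D W ZP ZQ : {set I}).

Definition matching W (t : I -> I) : Prop :=
  forall x, x \in W -> [/\ t x \in W, t x != x & t (t x) = x].

(** The support of a monomial times a Pfaffian on the rows [W] raised term by term to the power [q];
    coefficients are left to a later stage. *)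
Record matching_support ex S D n W (u0 : I -> I -> nat) (q : nat) : Prop := MatchingSupport {
  ms_card : #|W| = n;
  ms_dead : forall x, x \in W -> x \notin D;
  ms_pos : (0 < q)%N;
  ms_mem : forall v, v \in S -> exists2 t, matching W t &
    forall i j, ex v i j = (u0 i j + q * ((i \in W) && (t i == j)))%N;
  ms_all : forall t, matching W t -> exists2 v, v \in S &
    forall i j, ex v i j = (u0 i j + q * ((i \in W) && (t i == j)))%N }.

Definition mate (s : seq I) (x : I) : I := nth x s (partner (index x s)).

(** Consecutive entries of [s] become hyperbolic pairs. For a list of length [h.*2] all other rows
    are zero, so the Gram matrix is supported on the one matching [mate s]. *)
Definition sympB h (s : seq I) : 'M[K]_(m, h + h) :=
  mkPQ (fun x l => (index x s == l.*2)%:R) (fun x l => (index x s == l.*2.+1)%:R).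

Lemma index_mate h s x : uniq s -> size s = h.*2 -> x \in s ->
  (mate s x \in s) && (index (mate s x) s == partner (index x s)).
Proof.
move=> us ss xs; have lt : (partner (index x s) < size s)%N.
  by rewrite ss partner_lt // -ss index_mem.
by rewrite /mate mem_nth //= index_uniq // eqxx.
Qed.

Lemma mate_matching h s W : uniq s -> size s = h.*2 -> s =i W -> matching W (mate s).
Proof.
move=> us ss sW x; rewrite -sW => xs.
have /andP[h1 /eqP h2] := index_mate us ss xs.
split; first by rewrite -sW.
  by apply/eqP => E; move: h2; rewrite E => /eqP; rewrite eq_sym (negPf (partner_neq _)).
by rewrite {1}/mate h2 partnerK (set_nth_default x) ?index_mem // nth_index.
Qed.

Lemma mate_head z z' s : z != z' -> mate (z :: z' :: s) z = z' /\ mate (z :: z' :: s) z' = z.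
Proof. by move=> zz; rewrite /mate /= !eqxx /= (negPf zz). Qed.

Lemma om_sympB_neq h s x y : uniq s -> size s = h.*2 -> x \in s -> y \in s ->
  y != mate s x -> om (sympB h s) x y = 0.
Proof.
move=> us ss xs ys yx; have /andP[h1 /eqP h2] := index_mate us ss xs.
have hy : index y s != partner (index x s).
  by apply: contraNneq yx => E; apply/eqP/(@index_eq _ s) => //; rewrite h2.
rewrite /sympB om_mkPQ big1 // => l _; apply/eqP; rewrite subr_eq0.
case: (eqVneq (index x s) l.*2) hy => [->|n1] hy.
  rewrite (_ : (l.*2 == l.*2.+1) = false) ?mul0r; last by lia.
  by rewrite /partner odd_double in hy; rewrite (negPf hy) mulr0.
rewrite mul0r; case: (eqVneq (index x s) l.*2.+1) hy => [->|_] hy; last by rewrite mul0r.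
by rewrite /partner /= odd_double /= in hy; rewrite (negPf hy) mulr0.
Qed.

Lemma om_sympB_mate h s x : uniq s -> size s = h.*2 -> x \in s ->
  om (sympB h s) x (mate s x) != 0.
Proof.
move=> us ss xs; have /andP[h1 /eqP h2] := index_mate us ss xs.
have lt : ((index x s)./2 < h)%N by rewrite ltn_half_double -ss index_mem.
rewrite /sympB om_mkPQ (bigD1 (Ordinal lt)) //= h2 /partner big1 ?addr0.
  set n := index x s; case: ifP => on.
    have -> : (n == n./2.*2) = false by lia.
    have -> : n == n./2.*2.+1 by lia.
    have -> : n.-1 == n./2.*2 by lia.
    by rewrite mul0r mul1r sub0r oppr_eq0 oner_neq0.
  have -> : n == n./2.*2 by lia.
  have -> : (n == n./2.*2.+1) = false by lia.
  have -> : n.+1 == n./2.*2.+1 by lia.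
  by rewrite mul0r mul1r subr0 oner_neq0.
move=> l /eqP hl; apply/eqP; rewrite subr_eq0 -!natrM.
have hl' : (index x s)./2 != l by apply/eqP => E; apply: hl; apply: val_inj.
have n1 : index x s != l.*2 by apply: contraNneq hl' => ->; rewrite doubleK.
have n2 : index x s != l.*2.+1 by apply: contraNneq hl' => ->; rewrite /= uphalf_double.
by rewrite (negPf n1) (negPf n2) !mul0n.
Qed.

Lemma exists_matching h W k l : #|W| = h.*2 -> k \in W -> l \in W -> k != l ->
  exists s : seq I, [/\ uniq s, size s = h.*2, s =i W & exists s', s = k :: l :: s'].
Proof.
move=> cW kW lW kl; exists (k :: l :: enum (W :\ k :\ l)); split.
- by rewrite /= !inE !mem_enum !inE !eqxx /= andbF orbF kl enum_uniq.
- rewrite /= -cardE -cW (cardsD1 k W) kW (cardsD1 l (W :\ k)) !inE lW eq_sym kl.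
  by rewrite !add1n.
- move=> x; rewrite !inE mem_enum !inE.
  case: (eqVneq x k) => [->|_]; first by rewrite kW.
  by case: (eqVneq x l) => [->|_] //=; rewrite lW.
- by eexists.
Qed.

Lemma matching_sym W t i j : matching W t ->
  (i \in W) && (t i == j) = (j \in W) && (t j == i).
Proof.
by move=> h; apply/andP/andP => -[/h[h1 _ h3] /eqP <-]; rewrite h1 h3.
Qed.

(** Rows of [ZQ] are orthogonal to the first basis vector of plane [ord0], rows of [ZP] to the
    second. Specializing a row to such a vector kills every term containing its variable with one of
    these rows. *)
Definition in_hyperplanes h ZP ZQ (B : 'M[K]_(m, h.+1 + h.+1)) : Prop :=
  (forall k, k \in ZP -> B k (lshift _ ord0) = 0) /\
  (forall k, k \in ZQ -> B k (rshift _ ord0) = 0).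

Lemma in_hyperplanes_linear h ZP ZQ : linear_set (@in_hyperplanes h ZP ZQ).
Proof.
move=> x y t [x1 x2] [y1 y2]; split=> k kZ; rewrite !mxE.
  by rewrite x1 // y1 // mulr0 addr0.
by rewrite x2 // y2 // mulr0 addr0.
Qed.

Definition unitB h (t0 : 'I_h) (k l : I) : 'M[K]_(m, h + h) :=
  mkPQ (fun x t => ((x == k) && (t == t0))%:R) (fun x t => ((x == l) && (t == t0))%:R).

Lemma om_unitB h (t0 : 'I_h) k l : k != l -> om (unitB t0 k l) k l = 1.
Proof.
move=> kl; rewrite om_mkPQ (bigD1 t0) //= !eqxx (negPf kl) mul0r subr0 mulr1.
by rewrite big1 ?addr0 // => t /negPf->; rewrite !andbF !mul0r subrr.
Qed.

(** The polynomial is the monomial [u0] times a remainder. The remainder is nonzero at [sympB] of a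
    list beginning with [z] and [z']: only the matching of this list survives, and only these two
    rows use plane [ord0]. The last hypothesis keeps each variable of [u0] from vanishing
    identically: the last plane is unconstrained if [0 < h], while for [h = 0] the constrained plane
    is the only one. *)
Lemma nonvanishing_on_hyperplanes ex c S D h ZP ZQ W u0 q z z' :
  wf ex c S D -> matching_support ex S D h.+1.*2 W u0 q ->
  z \in W -> z' \in W -> z != z' -> z \notin ZP -> z' \notin ZQ ->
  (forall k l, k \notin D -> l \notin D -> k != l -> (0 < u0 k l)%N ->
     [|| (0 < h)%N, (k \notin ZP) && (l \notin ZQ) | (l \notin ZP) && (k \notin ZQ)]) ->
  exists2 B : 'M[K]_(m, h.+1 + h.+1), in_hyperplanes ZP ZQ B & pe ex c S D B != 0.
Proof.
move=> Wf [cW dW q0 memS allS] zW z'W zz zP zQ hu0.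
have [s [us ss sW [s' es]]] := exists_matching cW zW z'W zz.
have L0 : in_hyperplanes ZP ZQ (0 : 'M[K]_(m, h.+1 + h.+1)) by split=> k _; rewrite mxE.
pose J := [seq p : I * I <- enum {: I * I} |
  [&& p.1 \notin D, p.2 \notin D, p.1 != p.2 & (0 < u0 p.1 p.2)%N]].
have [|||B1 LB1 hB1] := @lp_genall K _ _ J (in_hyperplanes ZP ZQ)
   (fun p (B : 'M[K]_(m, h.+1 + h.+1)) => om B p.1 p.2) (@in_hyperplanes_linear h ZP ZQ).
- by exists 0.
- by move=> p _; apply: lp_om.
- move=> [k l]; rewrite mem_filter /= => /andP[/and4P[kD lD kl ukl] _].
  have /or3P[h0|/andP[h1 h2]|/andP[h1 h2]] := hu0 k l kD lD kl ukl.
  + exists (unitB ord_max k l); last by rewrite om_unitB ?oner_neq0.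
    have hm : ord0 == ord_max :> 'I_h.+1 = false by apply/negbTE; rewrite -val_eqE /=; lia.
    by split=> x _; rewrite ?mkPQ_l ?mkPQ_r hm andbF.
  + exists (unitB ord0 k l); last by rewrite om_unitB ?oner_neq0.
    split=> x xZ; rewrite ?mkPQ_l ?mkPQ_r.
      by case: eqVneq xZ h1 => [->->|].
    by case: eqVneq xZ h2 => [->->|].
  + exists (unitB ord0 l k); last by rewrite om_anti om_unitB ?oppr_eq0 ?oner_neq0 // eq_sym.
    split=> x xZ; rewrite ?mkPQ_l ?mkPQ_r.
      by case: eqVneq xZ h1 => [->->|].
    by case: eqVneq xZ h2 => [->->|].
pose e v i j := (ex v i j - u0 i j)%N.
have eE v : v \in S -> exists2 t, matching W t & forall i j, e v i j = (q * ((i \in W) && (t i == j)))%N.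
  by move=> /memS[t tW hv]; exists t => // i j; rewrite /e hv addKn.
have exE v : v \in S -> forall i j, ex v i j = (u0 i j + e v i j)%N.
  by move=> /memS[t tW hv] i j; rewrite /e hv addKn.
pose F2 (B : 'M[K]_(m, h.+1 + h.+1)) := \sum_(v <- S) c v * mon (e v) D B.
have peE B : pe ex c S D B = mon u0 D B * F2 B.
  rewrite /pe /F2 big_distrr [LHS]big_seq [RHS]big_seq; apply: eq_bigr => v vS /=.
  by rewrite mulrCA -monD; congr (_ * _); apply: mon_ext => i j _ _; rewrite exE.
have lpF2 : linepoly F2.
  by apply: lp_sum => v _; apply: lp_mul; [apply: lp_const | apply: lp_mon].
suff [B LB nB] : exists2 B, in_hyperplanes ZP ZQ B & F2 B != 0.
  have [||x [Lx x1 x2]] := @lp_gen2 K 'M[K]_(m, h.+1 + h.+1) (in_hyperplanes ZP ZQ) (fun B => mon u0 D B) F2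
     (@in_hyperplanes_linear h ZP ZQ) (@lp_mon K m u0 D h.+1) lpF2.
  - exists B1 => //; apply: mon_neq0 => i j iD jD ij u0ij; apply: (hB1 (i, j)).
    rewrite mem_filter /= iD jD u0ij mem_enum andbT andbT.
    by apply: contraTneq ij => ->; rewrite ltnn.
  - by exists B.
  by exists x; rewrite ?peE ?mulf_neq0.
have mW := mate_matching us ss sW.
have [v vS hv] := allS _ mW.
exists (sympB h.+1 s).
  split=> k kZ; rewrite ?mkPQ_l ?mkPQ_r es /=.
    by have /negPf-> : z != k by apply: contraNneq zP => ->.
  have /negPf-> : z' != k by apply: contraNneq zQ => ->.
  by case: (z == k).
have eS0 w : w \in S -> w != v -> mon (e w) D (sympB h.+1 s) = 0.
  move=> wS wv; have [t tW ht] := eE w wS.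
  have [x xW tx] : exists2 x, x \in W & t x != mate s x.
    case: (pickP [pred x in W | t x != mate s x]) => [x /andP[]|H]; first by exists x.
    case/eqP: wv; apply: (wf_inj Wf) => // i j; rewrite hv exE // ht.
    case: (boolP (i \in W)) => //= iW; have := H i; rewrite /= iW /= => /negbFE/eqP->.
    by [].
  have [tx1 tx2 _] := tW x xW.
  apply: (mon_eq0 (i := x) (j := t x)).
  - exact: dW.
  - exact: dW.
  - by rewrite eq_sym.
  - by move=> i j; rewrite !ht (matching_sym _ _ tW).
  - by rewrite ht xW eqxx /= muln1.
  - by apply: om_sympB_neq; rewrite ?sW.
rewrite /F2 (bigD1_seq v) ?(wf_uniq Wf) //= big_seq_cond big1 ?addr0; last first.
  by move=> w /andP[wS wv]; rewrite eS0 // mulr0.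
rewrite mulf_neq0 ?(wf_c Wf) //; apply: mon_neq0 => i j iD jD ij.
rewrite /e hv addKn; case: (boolP (i \in W)) => [iW|]; last by rewrite muln0.
case: eqP => [<- _|]; last by rewrite muln0.
by apply: om_sympB_mate; rewrite ?sW.
Qed.

End Matchings.

(** * The extremal case *)

Lemma dfact_gt0 n : (0 < dfact n)%N.
Proof.
suff: (0 < dfact n)%N /\ (0 < dfact n.+1)%N by case.
by elim: n => // n [h1 h2]; split=> //; change (0 < n.+2 * dfact n)%N; rewrite muln_gt0.
Qed.

Lemma dfact_gt1 n : (1 < dfact (n.+1.*2.+1))%N.
Proof. by rewrite dfact_step; apply: leq_trans (leq_pmulr _ (dfact_gt0 _)); rewrite addSn. Qed.

Lemma exists_other (T : eqType) (s t : seq T) : uniq s -> (size t < size s)%N ->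
  exists2 x, x \in s & x \notin t.
Proof.
move=> us st; have [/allP h|/allPn[x xs xt]] := boolP (all (mem t) s); last by exists x.
by move: (uniq_leq_size us h); rewrite leqNgt st.
Qed.

Section Extremal.
Variables (K : closedFieldType) (m : nat) (T : eqType).
Notation I := 'I_m.
Variables (w : T -> I -> I -> nat) (c : T -> K) (S : seq T) (D : {set I}) (h : nat).
Hypothesis Wf : wf w c S D.
Hypothesis vanishS : vanish h.+1 w c S D.
Hypothesis szS : size S = dfact (h.+1.*2.+1).
(** [wD], [wmin] and [row_used] describe the situation after the greatest common monomial has been
    divided out and the rows without remaining exponents have been declared dead. *)
Hypothesis wD : forall u i j, u \in S -> i \in D -> w u i j = 0%N.
Hypothesis wmin : forall i j, exists2 u, u \in S & w u i j = 0%N.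
Hypothesis row_used : forall o, o \notin D -> exists2 u, u \in S & exists j, (0 < w u o j)%N.
Hypothesis IH : forall (c' : T -> K) S' D', wf w c' S' D' -> vanish h w c' S' D' ->
  size S' = dfact (h.*2.+1) -> exists W u0 q, matching_support w S' D' h.+1.*2 W u0 q.

(** The graph whose edges are the variables occurring in some term. The goal is that it is complete
    on the live rows, of which there are [h.+2.*2]. *)
Definition nbr (o : I) : {set I} := [set k | has (fun u => 0 < w u o k)%N S].

Lemma nbrP o k : reflect (exists2 u, u \in S & (0 < w u o k)%N) (k \in nbr o).
Proof. by rewrite inE; apply: hasP. Qed.

Lemma nbr_sym o k : (k \in nbr o) = (o \in nbr k).
Proof. by apply/nbrP/nbrP => -[u uS h0]; exists u; rewrite // (wf_sym Wf). Qed.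

Lemma nbr_alive o k : k \in nbr o -> k \notin D.
Proof.
by move=> /nbrP[u uS]; rewrite (wf_sym Wf); apply: contraTN => kD; rewrite wD.
Qed.

Lemma nbr_irrefl o : o \notin nbr o.
Proof. by apply/nbrP => -[u _]; rewrite (wf_diag Wf). Qed.

Section Row.
Variables (o : I) (oD : o \notin D).
Notation rwo := (rw w D o).
Notation A := (rws w D o S).
Notation C := (fun a (B : 'M[K]_(m, h.+1 + h.+1)) => pe w c (cls w D o S a) (o |: D) B).

Lemma rwE u k : u \in S -> rwo u k = w u o k.
Proof.
move=> uS; rewrite ffunE in_setU1; case: eqP => [->|_] /=; first by rewrite (wf_diag Wf).
by case: ifP => // kD; rewrite (wf_sym Wf) wD.
Qed.

Lemma cls_neq0 a : a \in A -> cls w D o S a != [::].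
Proof.
move=> /rwsP[u uS ->]; apply/eqP => E; suff: u \in [::] by [].
by rewrite -E mem_cls uS eqxx.
Qed.

(** By the lower bound a class that vanishes in this rank has as many terms as [S], hence is all of
    it. The exponents in row [o] are then constant, so zero by [wmin], against [row_used]. *)
Lemma cls_not_vanish : {in A, forall a, ~ vanish h.+1 w c (cls w D o S a) (o |: D)}.
Proof.
move=> a aA va; have := nterms_lower_bound (wf_cls o a Wf) (cls_neq0 aA) va.
rewrite -szS /cls size_filter => le; have /allP H : all (fun u => rwo u == a) S.
  by rewrite all_count eqn_leq count_size.
have [u uS [j uj]] := row_used oD; have [v vS vj] := wmin o j.
move: uj; rewrite (rw_eq Wf uS vS) ?vj //.
by rewrite (eqP (H _ uS)) (eqP (H _ vS)).
Qed.

Lemma S_neq0 : S != [::].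
Proof. by have [u uS _] := row_used oD; case: S uS. Qed.

(** There are at least [(h.+1 + h.+1).+1] classes of at least [dfact (h.*2.+1)] terms, and the
    product of the two bounds is already the total. *)
Lemma size_classes : size A = (h.+1 + h.+1).+1 /\
  {in A, forall a, size (cls w D o S a) = dfact (h.*2.+1)}.
Proof.
have sA := many_classes Wf oD S_neq0 vanishS cls_not_vanish.
set d := dfact (h.*2.+1).
have ge a : a \in A -> (d <= size (cls w D o S a))%N.
  move=> aA; apply: (nterms_lower_bound (wf_cls o a Wf) (cls_neq0 aA)).
  exact: (cls_vanish Wf oD vanishS).
have tot : (\sum_(a <- A) size (cls w D o S a) = (h.+1 + h.+1).+1 * d)%N.
  by rewrite -size_cls szS dfact_step.
have le a : a \in A -> (size (cls w D o S a) + (size A).-1 * d <= (h.+1 + h.+1).+1 * d)%N.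
  move=> aA; rewrite -tot (bigD1_seq a) ?undup_uniq //= leq_add2l.
  have -> : ((size A).-1 * d = \sum_(b <- A | b != a) d)%N.
    rewrite big_const_seq iter_addn_0 mulnC; congr (_ * _)%N.
    have := count_predC (pred1 a) A; rewrite (count_uniq_mem _ (undup_uniq _)) aA add1n => <- //.
  rewrite big_seq_cond [X in (_ <= X)%N]big_seq_cond; apply: leq_sum => b /andP[bA _].
  exact: ge.
have d0 : (0 < d)%N := dfact_gt0 _.
have sA' : size A = (h.+1 + h.+1).+1.
  have [a aA] : exists a, a \in A.
    by case: (A) sA => // a s _; exists a; rewrite mem_head.
  apply/eqP; rewrite eqn_leq sA andbT -(leq_pmul2r d0); apply: leq_trans (le a aA).
  by have := ge a aA; nia.
split=> // a aA; apply/eqP; rewrite eqn_leq ge // andbT.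
by have := le a aA; rewrite sA' mulSn /=; lia.
Qed.

Lemma rows_disjoint a b k : a \in A -> b \in A -> (0 < a k)%N -> (0 < b k)%N -> a = b.
Proof.
move=> aA bA ak bk; have [B gB nz] := generic_classes cls_not_vanish.
have [sA _] := size_classes.
apply: (formrel_coordinate (@rowform_lin K m h.+1 B o) (rowform_general_position o gB)
  (undup_uniq _) _ _ (@row_relation _ _ _ _ _ _ _ _ _ B Wf oD vanishS) nz _ aA bA (i := k)) => //.
- by rewrite sA.
- have [u uS uk] := wmin o k; exists (rwo u); first exact: mem_rws.
  by rewrite rwE.
- by rewrite -lt0n.
- by rewrite -lt0n.
Qed.

Lemma row_degree u v : u \in S -> v \in S -> (\sum_k w u o k = \sum_k w v o k)%N.
Proof.
move=> uS vS; have [B gB nz] := generic_classes cls_not_vanish.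
have [sA _] := size_classes.
rewrite -(eq_bigr _ (fun k _ => rwE k uS)) -(eq_bigr _ (fun k _ => rwE k vS)).
apply: (formrel_degree (@rowform_lin K m h.+1 B o) (rowform_general_position o gB)
  (undup_uniq _) _ (@row_relation _ _ _ _ _ _ _ _ _ B Wf oD vanishS)); rewrite ?mem_rws ?sA //.
Qed.

Lemma row_pos u : u \in S -> exists k, (0 < w u o k)%N.
Proof.
move=> uS; have [v vS [j vj]] := row_used oD.
have : (0 < \sum_k w u o k)%N by rewrite (row_degree uS vS) (bigD1 j) //= addn_gt0 vj.
rewrite lt0n sum_nat_eq0 negb_forall => /existsP[k]; rewrite -lt0n => hk.
by exists k.
Qed.

Lemma class_support u : u \in S ->
  exists W u0 q, matching_support w (cls w D o S (rwo u)) (o |: D) h.+1.*2 W u0 q.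
Proof.
move=> uS; apply: (IH (wf_cls o _ Wf)); first by apply: cls_vanish; rewrite ?mem_rws.
by apply: (proj2 size_classes); rewrite mem_rws.
Qed.

(** The default [o] is never reached on row parts of [S], because [row_pos] gives each of them a
    variable. *)
Definition supp_pick (a : {ffun I -> nat}) : I := odflt o [pick k | 0 < a k]%N.

Lemma supp_pickP a : a \in A -> (0 < a (supp_pick a))%N.
Proof.
move=> /rwsP[u uS ->]; rewrite /supp_pick; case: pickP => [k //|H].
by have [k] := row_pos uS; rewrite -rwE // H.
Qed.

Definition rowmon (b : 'rV[K]_(h.+1 + h.+1)) (a : {ffun I -> nat})
  (B : 'M[K]_(m, h.+1 + h.+1)) : K := \prod_k rowform B o k b ^+ a k.

Lemma lp_rowmon b a : linepoly (rowmon b a).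
Proof.
apply: lp_prod => k _; apply: lp_exp; apply: lp_mul; first exact: lp_const.
apply: lp_sum => l _; apply: lp_sub; apply: lp_mul; (exact: lp_const || exact: lp_entry).
Qed.

Lemma rowmon_relation b B : \sum_(a <- A) C a B * rowmon b a B = 0.
Proof.
have H : zeros_on (rowform B o) set0 b by move=> z; rewrite inE.
rewrite -[RHS](@row_relation _ _ _ _ _ _ _ _ _ B Wf oD vanishS b H).
by apply: eq_bigr => a _; rewrite formmon_all.
Qed.

Lemma rowmon_eq0 b (a : {ffun I -> nat}) B k : (0 < a k)%N -> rowform B o k b = 0 -> rowmon b a B = 0.
Proof. by move=> ak E; rewrite /rowmon (bigD1 k) //= E expr0n gtn_eqF // mul0r. Qed.

Lemma rowmon_neq0 b (a : {ffun I -> nat}) B : (forall k, (0 < a k)%N -> rowform B o k b != 0) -> rowmon b a B != 0.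
Proof.
move=> H; apply/prodf_neq0 => k _; case E: (a k) => [|n]; first by rewrite expr0 oner_neq0.
by rewrite expf_neq0 // H // E.
Qed.

Definition vP : 'rV[K]_(h.+1 + h.+1) := delta_mx 0 (lshift _ ord0).
Definition vQ : 'rV[K]_(h.+1 + h.+1) := delta_mx 0 (rshift _ ord0).

Lemma rowform_vP B k : rowform B o k vP = (-1) ^+ (k < o)%N * B k (rshift _ ord0).
Proof.
congr (_ * _); rewrite (bigD1 ord0) //= big1 ?addr0; last first.
  move=> l l0; rewrite !mxE /= eq_lshift ?eq_rlshift (negPf l0) ?(negPf l0) !mul0r subrr //.
by rewrite !mxE ?eqxx ?eq_rlshift /= mul1r mul0r subr0.
Qed.

Lemma rowform_vQ B k : rowform B o k vQ = - ((-1) ^+ (k < o)%N * B k (lshift _ ord0)).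
Proof.
rewrite -mulrN; congr (_ * _); rewrite (bigD1 ord0) //= big1 ?addr0; last first.
  move=> l l0; rewrite !mxE /= eq_rshift ?eq_lrshift (negPf l0) ?(negPf l0) !mul0r subrr //.
by rewrite !mxE ?eqxx ?eq_lrshift /= mul1r mul0r sub0r.
Qed.

Lemma rowform_vP_eq0 B k : (rowform B o k vP == 0) = (B k (rshift _ ord0) == 0).
Proof. by rewrite rowform_vP mulf_eq0 signr_eq0. Qed.

Lemma rowform_vQ_eq0 B k : (rowform B o k vQ == 0) = (B k (lshift _ ord0) == 0).
Proof. by rewrite rowform_vQ oppr_eq0 mulf_eq0 signr_eq0. Qed.

(* If a row part [w u o] had two variables [i] and [j], imposing [h.+1 + h.+1 - 2] conditions would
   leave only two other classes; specializing the row to two different vectors then gives two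
   incompatible relations between their coefficients. *)
Lemma row_unique u i j : u \in S -> (0 < w u o i)%N -> (0 < w u o j)%N -> i = j.
Proof.
move=> uS ui uj; apply/eqP; apply: contraT => ij.
have [sA _] := size_classes; have uA : uniq A := undup_uniq _.
pose a2 := rwo u; have a2A : a2 \in A by apply: mem_rws.
have [a0 a0A a02] : exists2 a, a \in A & a \notin [:: a2] by apply: exists_other; rewrite ?sA.
have [a1 a1A a12] : exists2 a, a \in A & a \notin [:: a2; a0].
  by apply: exists_other; rewrite ?sA //= !addSn addnS.
move: a02 a12; rewrite !inE negb_or => a02 /andP[a12 a10].
have a2i : (0 < a2 i)%N by rewrite rwE.
have a2j : (0 < a2 j)%N by rewrite rwE.
(* Besides [a2], [a0] and [a1] there are [h + h] classes; [Z] contains one variable of each. *)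
pose A' := [seq a <- A | a \notin [:: a2; a0; a1]].
pose Z := [set x in map supp_pick A'].
have disj a b k : a \in A -> b \in A -> a != b -> (0 < a k)%N -> (b k = 0)%N.
  move=> aA bA ab ak; apply/eqP; rewrite -leqn0 leqNgt; apply: contraNN ab => bk.
  by apply/eqP/(rows_disjoint aA bA ak bk).
have cZ : (#|Z| <= h + h)%N.
  rewrite cardsE; apply: leq_trans (card_size _) _; rewrite size_map size_filter.
  have e1 := count_predC (mem [:: a2; a0; a1]) A.
  have e2 : (3 <= count (mem [:: a2; a0; a1]) A)%N.
    rewrite -size_filter; apply: (@uniq_leq_size _ [:: a2; a0; a1]).
      by rewrite /= !inE negb_or eq_sym a02 eq_sym a12 eq_sym a10.
    by move=> x; rewrite !inE mem_filter !inE => /or3P[]/eqP->; rewrite eqxx ?orbT.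
  have e3 : count (predC (mem [:: a2; a0; a1])) A = count (fun a => a \notin [:: a2; a0; a1]) A.
    exact: eq_count.
  rewrite -e3; move: e1 e2; rewrite sA; move: (count _ _) (count _ _) => n1 n2; lia.
have Zsupp a k : a \in [:: a2; a0; a1] -> a \in A -> (0 < a k)%N -> k \notin Z.
  move=> a3 aA ak; rewrite inE; apply/mapP => -[b]; rewrite mem_filter => /andP[b3 bA] E.
  have ab : a != b by apply: contraNneq b3 => <-.
  by have := supp_pickP bA; rewrite -E (disj a b).
(* Row [vP] kills [a2] through [i], row [vQ] kills it through [j], and both kill the classes of [A']
   through [Z]. Each leaves a relation between [a0] and [a1] alone. *)
pose ZP := j |: Z; pose ZQ := i |: Z.
have killP a B : in_hyperplanes ZP ZQ B -> a \in A -> a != a0 -> a != a1 -> rowmon vP a B = 0.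
  move=> [LP LQ] aA n0 n1; case: (eqVneq a a2) => [->|n2].
    by apply: (rowmon_eq0 a2i); apply/eqP; rewrite rowform_vP_eq0 LQ // setU11.
  apply: (rowmon_eq0 (supp_pickP aA)); apply/eqP; rewrite rowform_vP_eq0 LQ //.
  rewrite !inE map_f ?orbT // mem_filter aA !inE !negb_or n0 n1 n2 //.
have killQ a B : in_hyperplanes ZP ZQ B -> a \in A -> a != a0 -> a != a1 -> rowmon vQ a B = 0.
  move=> [LP LQ] aA n0 n1; case: (eqVneq a a2) => [->|n2].
    by apply: (rowmon_eq0 a2j); apply/eqP; rewrite rowform_vQ_eq0 LP // setU11.
  apply: (rowmon_eq0 (supp_pickP aA)); apply/eqP; rewrite rowform_vQ_eq0 LP //.
  rewrite !inE map_f ?orbT // mem_filter aA !inE !negb_or n0 n1 n2 //.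
have rel2 b B : (forall a, a \in A -> a != a0 -> a != a1 -> rowmon b a B = 0) ->
    C a0 B * rowmon b a0 B + C a1 B * rowmon b a1 B = 0.
  move=> H; rewrite -[RHS](rowmon_relation b B) (bigD1_seq a0) //=; congr (_ + _).
  rewrite (big_rem a1) //= a10 big_seq_cond big1 ?addr0 // => a /andP[].
  by rewrite mem_rem_uniq // inE => /andP[n1 aA] n0; rewrite H ?mulr0.
(* The determinant of the two relations. On the linear set its product with [C a0] is zero, so a
   contradiction follows once each of the two is nonzero somewhere on that set. *)
pose Delta B := rowmon vP a0 B * rowmon vQ a1 B - rowmon vQ a0 B * rowmon vP a1 B.
have lpD : linepoly Delta by apply: lp_sub; apply: lp_mul; apply: lp_rowmon.
have [||B [LB]] := @lp_gen2 K _ (in_hyperplanes ZP ZQ) (C a0) Delta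
    (@in_hyperplanes_linear K m h ZP ZQ) (@lp_pe K m T w c _ _ h.+1) lpD.
- have [u0' u0S ->] := rwsP a0A; have [W [u0 [q ms]]] := class_support u0S.
  (* [W] has [h.+1.*2] elements and [Z] at most [h + h], which leaves two rows free of the
     conditions from [Z]. *)
  have cWZ : (1 < #|W :\: Z|)%N.
    have e1 := cardsID Z W; rewrite (ms_card ms) doubleS -addnn in e1.
    have e2 := leq_trans (subset_leq_card (subsetIr W Z)) cZ.
    by move: e1 e2; move: #|_| #|_| => n1 n2; lia.
  have /card_gt1P[x [y [xW yW xy]]] := cWZ.
  have [z [z' [zW z'W zz zj zi]]] : exists z z',
      [/\ z \in W :\: Z, z' \in W :\: Z, z != z', z != j & z' != i].
    case: (eqVneq x j) => [xj|xj]; last case: (eqVneq y i) => [yi|yi].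
    - by exists y, x; rewrite xW yW -xj eq_sym xy xj eq_sym ij.
    - by exists y, x; rewrite xW yW yi ij eq_sym -yi xy.
    - by exists x, y.
  move: zW z'W; rewrite !inE => /andP[zZ zW] /andP[z'Z z'W].
  apply: (nonvanishing_on_hyperplanes (wf_cls o _ Wf) ms zW z'W zz).
  + by rewrite !inE negb_or zj.
  + by rewrite !inE negb_or zi.
  + move=> k l _ _ kl _; case: posnP => //= h0.
    have Z0 : Z = set0 by apply/eqP; rewrite -cards_eq0 -leqn0; move: cZ; rewrite h0.
    rewrite /ZP /ZQ Z0 !setU0 !inE.
    have ji : j != i by rewrite eq_sym.
    case: (eqVneq k j) kl => [->|kj] kl /=; first by rewrite eq_sym kl ji.
    by case: (eqVneq l i) kl => [->|li] //= ->; rewrite ij.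
(* Making row [s0] orthogonal to [vP] kills the first product of [Delta], while the second stays
   nonzero. *)
- pose s0 := supp_pick a0.
  exists (mkPQ (fun k _ => (k \notin ZP)%:R) (fun k _ => ((k \notin ZQ) && (k != s0))%:R)).
    by split=> k kZ; rewrite ?mkPQ_l ?mkPQ_r kZ.
  rewrite /Delta (rowmon_eq0 (b := vP) (supp_pickP a0A)); last first.
    by apply/eqP; rewrite rowform_vP_eq0 mkPQ_r eqxx andbF.
  rewrite mul0r sub0r oppr_eq0 mulf_neq0 //; apply: rowmon_neq0 => k ak.
    rewrite rowform_vQ_eq0 mkPQ_l !inE negb_or.
    have -> : k != j by apply: contraTneq ak => ->; rewrite (disj a2 a0) // eq_sym.
    have := Zsupp a0 k; rewrite !inE eqxx orbT => /(_ isT a0A ak) ->.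
    by rewrite oner_neq0.
  rewrite rowform_vP_eq0 mkPQ_r !inE negb_or.
  have -> : k != i by apply: contraTneq ak => ->; rewrite (disj a2 a1) // eq_sym.
  have -> : k != s0.
    by apply: contraTneq ak => ->; rewrite (disj a0 a1) ?supp_pickP // eq_sym.
  have := Zsupp a1 k; rewrite !inE eqxx !orbT => /(_ isT a1A ak) ->.
  by rewrite oner_neq0.
move=> C0 /eqP[]; have E1 := rel2 vP B (fun a => @killP a B LB).
have E2 := rel2 vQ B (fun a => @killQ a B LB).
apply: (mulfI C0); rewrite mulr0 /Delta.
have -> : C a0 B * (rowmon vP a0 B * rowmon vQ a1 B - rowmon vQ a0 B * rowmon vP a1 B)
  = (C a0 B * rowmon vP a0 B + C a1 B * rowmon vP a1 B) * rowmon vQ a1 B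
    - (C a0 B * rowmon vQ a0 B + C a1 B * rowmon vQ a1 B) * rowmon vP a1 B by ring.
by rewrite E1 E2 !mul0r subrr.
Qed.

Lemma supp_pick_rw u k : u \in S -> (0 < w u o k)%N -> supp_pick (rwo u) = k.
Proof.
move=> uS uk; apply: (row_unique uS) => //.
by rewrite -(rwE _ uS) supp_pickP // mem_rws.
Qed.

(** Each row part is a power of one variable and distinct row parts have distinct variables, so
    neighbours correspond to classes. *)
Lemma card_nbr : #|nbr o| = (h.+1 + h.+1).+1.
Proof.
have [<- _] := size_classes; rewrite -(size_map supp_pick).
have /card_uniqP <- : uniq (map supp_pick A).
  rewrite map_inj_in_uniq ?undup_uniq // => a b aA bA E.
  by apply: (rows_disjoint (k := supp_pick a)); rewrite ?supp_pickP // E supp_pickP.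
apply: eq_card => k; apply/nbrP/mapP => [[u uS uk]|[a aA ->]].
  by exists (rwo u); rewrite ?mem_rws // (supp_pick_rw uS uk).
have [u uS E] := rwsP aA; exists u => //.
by rewrite -(rwE _ uS) -E supp_pickP.
Qed.

(* Fixing a row vector and putting the rows of [nbr o :\ j] in a hyperplane kills every class but
   that of [u], whose coefficient must therefore vanish there. *)
Lemma class_support_nbr u j : u \in S -> (0 < w u o j)%N ->
  exists W u0 q, matching_support w (cls w D o S (rwo u)) (o |: D) h.+1.*2 W u0 q /\
    (W = nbr o :\ j \/
     h = 0%N /\ exists k l, [/\ k \in nbr o :\ j, l \in nbr o :\ j, k != l & (0 < u0 k l)%N]).
Proof.
move=> uS uj; have [W [u0 [q ms]]] := class_support uS; exists W, u0, q; split=> //.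
set J := nbr o :\ j; have jN : j \in nbr o by apply/nbrP; exists u.
have cJ : #|J| = h.+1.*2.
  by have := card_nbr; rewrite (cardsD1 j) jN add1n addnn => -[].
apply: NNPP => /not_or_and[WJ H].
(* [W] and [J] have the same size, so if they differ some row of [W] escapes the hyperplane
   condition imposed on [J]. *)
have [z' z'W z'J] : exists2 z', z' \in W & z' \notin J.
  apply/subsetPn; apply/negP => WsJ; apply: WJ; apply/eqP.
  by rewrite eqEcard WsJ cJ (ms_card ms) leqnn.
have [z zW zz'] : exists2 z, z \in enum W & z \notin [:: z'].
  by apply: exists_other; rewrite ?enum_uniq // -cardE (ms_card ms).
rewrite mem_enum in zW; rewrite inE in zz'.
have [||B1 LB1 C1] := nonvanishing_on_hyperplanes (ZP := set0) (ZQ := J)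
  (wf_cls o _ Wf) ms zW z'W zz' _ z'J.
- by rewrite inE.
(* The condition on [u0] fails only for [h = 0] and a variable of [u0] inside [J], which is the
   second alternative. *)
- move=> k l _ _ kl ukl; case: posnP => //= h0; rewrite !inE.
  apply/norP => -[/negPn lJ /negPn kJ]; apply: H; split=> //.
  by exists k, l; rewrite !inE.
have jJ : j \notin J by rewrite !inE eqxx.
have [||B [LB nC nX]] := @lp_gen2 K _ (in_hyperplanes set0 J) (C (rwo u)) (rowmon vP (rwo u))
    (@in_hyperplanes_linear K m h set0 J) (@lp_pe K m T w c _ _ h.+1) (lp_rowmon _ _).
- by exists B1.
- exists (mkPQ (fun _ _ => 0) (fun k _ => (k == j)%:R)).
    split=> k kZ; rewrite ?mkPQ_l ?mkPQ_r //.
    by rewrite (_ : k == j = false) //; apply: contraNF jJ => /eqP<-.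
  apply: rowmon_neq0 => k; rewrite rwE // => uk.
  by rewrite rowform_vP_eq0 mkPQ_r (row_unique uS uk uj) eqxx oner_neq0.
have /eqP := rowmon_relation vP B; rewrite (bigD1_seq (rwo u)) ?mem_rws ?undup_uniq //=.
rewrite big_seq_cond big1 ?addr0 ?mulf_eq0 ?(negPf nC) ?(negPf nX) // => a /andP[aA au].
rewrite (rowmon_eq0 (supp_pickP aA)) ?mulr0 //.
have [v vS E] := rwsP aA; have [k vk] := row_pos vS.
apply/eqP; rewrite rowform_vP_eq0 (proj2 LB) // E (supp_pick_rw vS vk) !inE.
apply/andP; split; last by apply/hasP; exists v.
apply: contraNneq au => kj; rewrite E; apply/eqP.
by apply: (rows_disjoint (k := j)); rewrite ?mem_rws ?rwE // -kj.
Qed.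

(** If [W] is [nbr o :\ j], the induction hypothesis provides all matchings. In the exceptional case
    [h = 0] the set has two elements, hence one matching, and [u] itself contains its edge. *)
Lemma class_all_matchings u j t : u \in S -> (0 < w u o j)%N -> matching (nbr o :\ j) t ->
  exists2 v, v \in S & rwo v = rwo u /\ forall k, k \in nbr o :\ j -> (0 < w v k (t k))%N.
Proof.
move=> uS uj tJ; have [W [u0 [q [ms H]]]] := class_support_nbr uS uj.
have jN : j \in nbr o by apply/nbrP; exists u.
case: H => [WJ|[h0 [k [l [kJ lJ kl ukl]]]]].
  rewrite -WJ in tJ; have [v] := ms_all ms tJ; rewrite mem_cls => /andP[vS /eqP vu] hv.
  exists v => //; split=> // k kJ; rewrite -WJ in kJ.
  by rewrite hv kJ eqxx muln1 addn_gt0 (ms_pos ms) orbT.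
exists u => //; split=> // x xJ.
have uc : u \in cls w D o S (rwo u) by rewrite mem_cls uS eqxx.
have wkl : (0 < w u k l)%N.
  by have [t' _ ->] := ms_mem ms uc; rewrite addn_gt0 ukl.
have cJ : #|nbr o :\ j| = 2.
  by have := card_nbr; rewrite (cardsD1 j) jN h0 => -[].
have JE : nbr o :\ j = [set k; l].
  apply/eqP; rewrite eq_sym eqEcard cJ cards2 kl andbT.
  by apply/subsetP => y; rewrite !inE => /orP[]/eqP->; [move: kJ | move: lJ]; rewrite !inE.
have [tx txx _] := tJ x xJ; move: xJ tx txx; rewrite JE !inE => /orP[]/eqP->.
  by case/orP=> /eqP->; rewrite ?eqxx.
by case/orP=> /eqP->; rewrite ?eqxx // (wf_sym Wf).
Qed.

Lemma class_outside u v j x l : (0 < h)%N -> u \in S -> v \in S -> rwo v = rwo u ->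
  (0 < w u o j)%N -> x \notin nbr o :\ j -> w u x l = w v x l.
Proof.
move=> h0 uS vS vu uj xJ; have [W [u0 [q [ms H]]]] := class_support_nbr uS uj.
case: H => [WJ|[E _]]; last by rewrite E in h0.
rewrite -WJ in xJ.
have uc : u \in cls w D o S (rwo u) by rewrite mem_cls uS eqxx.
have vc : v \in cls w D o S (rwo u) by rewrite mem_cls vS vu eqxx.
have [t _ ->] := ms_mem ms uc; have [t' _ ->] := ms_mem ms vc.
by rewrite (negPf xJ).
Qed.

End Row.

(** For a third neighbour [j], some matching of [nbr o :\ j] pairs [k] with [l], and every such
    matching occurs in a term. *)
Lemma nbr_clique o k l : o \notin D -> k \in nbr o -> l \in nbr o -> k != l -> l \in nbr k.
Proof.
move=> oD kN lN kl.
have [j] : exists2 j, j \in enum (nbr o) & j \notin [:: k; l].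
  by apply: exists_other; rewrite ?enum_uniq // -cardE card_nbr //= !addSn addnS.
rewrite mem_enum => jN jkl.
have /andP[jk jl] : (j != k) && (j != l) by move: jkl; rewrite !inE negb_or.
have [u uS uj] := nbrP _ _ jN.
have kJ : k \in nbr o :\ j by rewrite in_setD1 eq_sym jk.
have lJ : l \in nbr o :\ j by rewrite in_setD1 eq_sym jl.
have cJ : #|nbr o :\ j| = h.+1.*2.
  by have := card_nbr oD; rewrite (cardsD1 j) jN add1n addnn => -[].
have [s [us ss sJ [s' es]]] := exists_matching cJ kJ lJ kl.
have [v vS [_ /(_ k kJ)]] := class_all_matchings oD uS uj (mate_matching us ss sJ).
by rewrite es (proj1 (mate_head s' kl)) => vkl; apply/nbrP; exists v.
Qed.

(** The clique property gives one inclusion, and both sides have [(h.+1 + h.+1).+1] elements. *)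
Lemma nbr_component o k : o \notin D -> k \in o |: nbr o -> nbr k = (o |: nbr o) :\ k.
Proof.
move=> oD; rewrite in_setU1 => /predU1P[->|kN].
  by rewrite setU1K ?nbr_irrefl.
have kD := nbr_alive kN.
apply/esym/eqP; rewrite eqEcard (card_nbr kD); apply/andP; split; last first.
  have := cardsD1 k (o |: nbr o); rewrite cardsU1 nbr_irrefl (card_nbr oD).
  by rewrite in_setU1 kN orbT !add1n => -[<-].
apply/subsetP => x; rewrite in_setD1 in_setU1 => /andP[xk /predU1P[->|xN]].
  by rewrite nbr_sym.
by apply: (nbr_clique oD); rewrite // eq_sym.
Qed.

Lemma distinct_scalars n : exists2 s : seq K, uniq s & size s = n.
Proof.
elim: n => [|n [s us ss]]; first by exists [::].
have /closed_nonrootP[t] : \prod_(a <- s) ('X - a%:P) != 0 by rewrite monic_neq0 ?monic_prod_XsubC.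
by rewrite root_prod_XsubC => ts; exists (t :: s); rewrite /= ?ts ?ss.
Qed.

(** Suppose [x] lies outside the component of [o]. For [0 < h], two terms of one class at [o] differ
    only inside [nbr o], so they lie in one class at [x] and differ only inside [nbr x]; these sets
    are disjoint, so the terms coincide. For [h = 0] classes are singletons, and a specialization
    isolates one of the three terms. *)
Lemma component_full o x : o \notin D -> x \notin D -> x \in o |: nbr o.
Proof.
move=> oD xD; apply: contraT => xW.
have sep y : y \in nbr x -> y \notin o |: nbr o.
  rewrite nbr_sym => xy; apply: contraNN xW => yW.
  by move: xy; rewrite (nbr_component oD yW) in_setD1 => /andP[].
have [u uS _] := row_used oD.
have [j uj] := row_pos oD uS.
have [y uy] := row_pos xD uS.
have yN : y \in nbr x by apply/nbrP; exists u.
have [h0|h0] := posnP h.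
  have szS3 : size S = 3 by rewrite szS h0.
  have [v vS] : exists2 v, v \in S & v \notin [:: u] by apply: exists_other; rewrite ?(wf_uniq Wf) ?szS3.
  rewrite inE => vu; have [t tS] : exists2 t, t \in S & t \notin [:: u; v].
    by apply: exists_other; rewrite ?(wf_uniq Wf) ?szS3.
  rewrite !inE negb_or => /andP[tu tv].
  have [k vk] := row_pos oD vS.
  have kN : k \in nbr o by apply/nbrP; exists v.
  (* For [h = 0] every class is a single term, so a variable determines the term in which it
     occurs. *)
  have alone i l a b : i \notin D -> a \in S -> b \in S -> (0 < w a i l)%N -> (0 < w b i l)%N -> a = b.
    move=> iD aS bS al bl; have E : rw w D i a = rw w D i b.
      by apply: (rows_disjoint iD (k := l)); rewrite ?mem_rws ?rwE.
    have [_ /(_ _ (mem_rws w D i aS))] := size_classes iD.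
    rewrite h0 => sz1; have aC : a \in cls w D i S (rw w D i a) by rewrite mem_cls aS eqxx.
    have bC : b \in cls w D i S (rw w D i a) by rewrite mem_cls bS E eqxx.
    case: (cls w D i S (rw w D i a)) sz1 aC bC => [|e [|]] // _.
    by rewrite !inE => /eqP-> /eqP->.
  have [s us ss] := distinct_scalars m.
  (* Giving [x] and [y] the same scalar, and likewise [o] and [k], kills exactly the variables of
     these two pairs, hence the terms [u] and [v] but not [t]. *)
  pose f i := if i == x then y else if i == o then k else i.
  have yk : y != k by apply: contraTneq (sep y yN) => ->; rewrite negbK setU1r.
  have yo : y != o by apply: contraTneq (sep y yN) => ->; rewrite negbK setU11.
  have kx : k != x by apply: contraNneq xW => <-; rewrite setU1r.
  have ox : o != x by apply: contraNneq xW => <-; rewrite setU11.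
  have yx : y != x by apply: contraTneq yN => ->; apply: nbr_irrefl.
  have ko : k != o by apply: contraTneq kN => ->; apply: nbr_irrefl.
  pose B : 'M[K]_(m, 1 + 1) := mkPQ (fun _ _ => 1) (fun i _ => s`_(f i)).
  have omB i l : om B i l = s`_(f l) - s`_(f i).
    by rewrite om_mkPQ big_ord1 mul1r mulr1.
  have v1 : vanish 1 w c S D by rewrite -h0; exact: vanishS.
  have /eqP := v1 B; rewrite /pe (bigD1_seq t) ?(wf_uniq Wf) //= big_seq_cond big1; last first.
    move=> b /andP[bS bt].
    suff -> : mon (w b) D B = 0 by rewrite mulr0.
    have : b \in [:: u; v; t].
      have [] := @uniq_min_size _ [:: u; v; t] S; rewrite /= ?szS3 //.
      - by rewrite !inE negb_or eq_sym vu eq_sym tu eq_sym tv.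
      - by move=> z; rewrite !inE => /or3P[]/eqP->.
      - by move=> _ ->.
    rewrite !inE (negPf bt) orbF => /orP[]/eqP->.
      apply: (mon_eq0 xD (nbr_alive yN) _ (wf_sym Wf u)) => //; first by rewrite eq_sym.
      by rewrite omB /f (negPf yx) (negPf yo) eqxx subrr.
    apply: (mon_eq0 oD (nbr_alive kN) _ (wf_sym Wf v)) => //; first by rewrite eq_sym.
    by rewrite omB /f (negPf kx) (negPf ko) eqxx (negPf ox) subrr.
  rewrite addr0 mulf_eq0 (negPf (wf_c Wf tS)) /= => /negPn; case/negP.
  apply: mon_neq0 => i l iD lD il til; rewrite omB subr_eq0.
  rewrite nth_uniq ?ss ?ltn_ord //.
  have txy : w t x y = 0%N.
    by apply/eqP; rewrite -leqn0 leqNgt; apply: contraNN tu => txy; rewrite (alone x y t u).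
  have tok : w t o k = 0%N.
    by apply/eqP; rewrite -leqn0 leqNgt; apply: contraNN tv => tok; rewrite (alone o k t v).
  have nil a : w t a a = 0%N by exact: (wf_diag Wf).
  have tsym a b : w t a b = w t b a by exact: (wf_sym Wf).
  rewrite val_eqE; apply: contraTneq til; rewrite /f -leqNgt leqn0.
  case: (eqVneq l x) => [->|lx]; case: (eqVneq i x) => [->|ix].
  - by rewrite nil.
  - case: (eqVneq i o) => [_ E|_ <-]; first by rewrite E eqxx in yk.
    by rewrite tsym txy.
  - case: (eqVneq l o) => [_ E|_ ->]; first by rewrite -E eqxx in yk.
    by rewrite txy.
  - case: (eqVneq l o) => [->|lo]; case: (eqVneq i o) => [->|io].
    + by rewrite nil.
    + by move=> <-; rewrite tsym tok.
    + by move=> ->; rewrite tok.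
    + by move=> ->; rewrite nil.
have [v] : exists2 v, v \in cls w D o S (rw w D o u) & v \notin [:: u].
  apply: exists_other; first by rewrite filter_uniq ?(wf_uniq Wf).
  rewrite (proj2 (size_classes oD)) ?mem_rws //; case: (h) h0 => // n _; exact: dfact_gt1.
rewrite mem_cls inE => /andP[vS /eqP vu]; case/eqP; apply: (wf_inj Wf) => // i l.
have out i' l' : i' \notin nbr o :\ j -> w u i' l' = w v i' l' by apply: (class_outside oD _ h0 uS vS vu uj).
have [iJ|/out->] // := boolP (i \in nbr o :\ j).
have xvu : rw w D x v = rw w D x u.
  apply/ffunP => k; rewrite !rwE // out //.
  by apply: contraNN xW; rewrite in_setD1 => /andP[_ ?]; rewrite setU1r.
apply/esym; apply: (class_outside xD _ h0 uS vS xvu uy).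
rewrite in_setD1 negb_and negbK orbC; apply/orP; left; apply/negP => /sep.
by move: iJ; rewrite in_setD1 => /andP[_ iN]; rewrite setU1r.
Qed.

(** [W] is the closed neighbourhood of one live row [o], and [q] is the degree in row [o], the same
    for all terms. Every other row of [W] is joined to [o] in some term, and its degree too is the
    same in all terms, so each variable occurs with exponent [q]. *)
Lemma reduced_structure : exists W q, matching_support w S D h.+2.*2 W (fun _ _ => 0%N) q.
Proof.
have [o oD] : exists o, o \notin D.
  case: (pickP [pred o | o \notin D]) => [o oD|H]; first by exists o.
  have : (1 < size S)%N by rewrite szS dfact_gt1.
  have := wf_uniq Wf; case: S (wf_inj Wf) wD => [|a [|b s]] //= inj hD /andP[].
  rewrite inE negb_or => /andP[/eqP ab _] _ _; case: ab.
  apply: inj; rewrite ?inE ?eqxx ?orbT // => i j.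
  by have /negbFE iD := H i; rewrite !hD // !inE eqxx ?orbT.
have [u0 u0S _] := row_used oD.
pose W := o |: nbr o; pose q := (\sum_k w u0 o k)%N.
have WD x : x \in W -> x \notin D by rewrite in_setU1 => /predU1P[->|/nbr_alive].
have nbrW x : x \in W -> nbr x = W :\ x by apply: nbr_component.
have val u i k : u \in S -> i \notin D -> (0 < w u i k)%N -> (\sum_l w u i l = w u i k)%N.
  move=> uS iD uk; rewrite (bigD1 k) //= big1 ?addn0 // => l lk.
  by apply/eqP; rewrite -leqn0 leqNgt; apply: contraNN lk => ul; rewrite (row_unique iD uS ul uk).
have valo u k : u \in S -> (0 < w u o k)%N -> w u o k = q.
  by move=> uS uk; rewrite -(val u o k) // (row_degree oD uS u0S).
have valW u i k : u \in S -> i \in W -> (0 < w u i k)%N -> w u i k = q.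
  move=> uS iW uk; move: (iW); rewrite in_setU1 => /predU1P[io|/nbrP[v vS vi]].
    by rewrite io in uk *; apply: valo.
  have vi' : (0 < w v i o)%N by rewrite (wf_sym Wf).
  rewrite -(val u i k uS (WD _ iW) uk) (row_degree (WD _ iW) uS vS).
  by rewrite (val v i o vS (WD _ iW) vi') (wf_sym Wf) (valo _ _ vS vi).
have struct v t : v \in S -> matching W t -> (forall i, i \in W -> (0 < w v i (t i))%N) ->
    forall i j, w v i j = (q * ((i \in W) && (t i == j)))%N.
  move=> vS tW ht i j; case: (boolP (i \in W)) => [iW|iW] /=; last first.
    rewrite muln0 wD //; apply: contraNT iW => iD; exact: (component_full oD iD).
  case: eqP => [<-|tij]; first by rewrite muln1 valW // ht.
  rewrite muln0; apply/eqP; rewrite -leqn0 leqNgt; apply/negP => vij; case: tij.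
  exact: (row_unique (WD _ iW) vS (ht i iW) vij).
exists W, q; split.
- by rewrite cardsU1 nbr_irrefl card_nbr // addnn !doubleS.
- exact: WD.
- by have [k uk] := row_pos oD u0S; rewrite -(valo u0 k u0S uk).
- move=> v vS; pose t i := odflt i [pick k | 0 < w v i k]%N.
  have ht i : i \in W -> (0 < w v i (t i))%N.
    move=> iW; rewrite /t; case: pickP => [k //|H].
    by have [k] := row_pos (WD _ iW) vS; rewrite H.
  have tW : matching W t.
    move=> i iW; have tiN : t i \in nbr i by apply/nbrP; exists v; rewrite ?ht.
    move: (tiN); rewrite nbrW // in_setD1 => /andP[ti tiW]; split=> //.
    apply: (row_unique (WD _ tiW) vS); first exact: ht.
    by rewrite (wf_sym Wf) ht.
  by exists t => // i j; rewrite add0n; apply: struct.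
- move=> t tW; have oW : o \in W by rewrite setU11.
  have [toW too tto] := tW o oW.
  have toN : t o \in nbr o by rewrite nbrW // in_setD1 too.
  have [u uS uto] := nbrP _ _ toN.
  (* The edge from [o] to [t o] occurs in a term [u], and the class of [u] at [o] contains every
     matching of the remaining rows of [W]. *)
  have tJ : matching (nbr o :\ t o) t.
    move=> x; rewrite (nbrW o) // !in_setD1 => /and3P[x1 x2 xW].
    have [txW txx ttx] := tW x xW; split=> //; apply/and3P; split=> //.
      by apply: contraNneq x2 => E; rewrite -ttx E tto.
    by apply: contraNneq x1 => E; rewrite -E ttx.
  have [v vS [vu hv]] := class_all_matchings oD uS uto tJ.
  have vto : (0 < w v o (t o))%N by rewrite -(rwE o (t o) vS) vu (rwE o (t o) uS).
  exists v => // i j; rewrite add0n; apply: struct => // x xW.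
  case: (eqVneq x o) => [->|xo] //; case: (eqVneq x (t o)) => [->|xto].
    by rewrite tto (wf_sym Wf).
  by apply: hv; rewrite nbrW // !in_setD1 xto xo.
Qed.

End Extremal.

(** * Removal of the greatest common monomial *)

Section Reduction.
Variables (K : closedFieldType) (m : nat) (T : eqType).
Notation I := 'I_m.
Implicit Types (ex : T -> I -> I -> nat) (c : T -> K) (S : seq T) (D W : {set I}).

Lemma mon_nonzero_exists (e : I -> I -> nat) D h :
  exists B : 'M[K]_(m, h.+1 + h.+1), mon e D B != 0.
Proof.
have [|||B _ hB] := @lp_genall K _ _ [seq p : I * I <- enum {: I * I} | p.1 != p.2] (fun _ => True)
   (fun p (B : 'M[K]_(m, h.+1 + h.+1)) => om B p.1 p.2) (@linear_setT K _).
- by exists 0.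
- by move=> p _; apply: lp_om.
- move=> [k l]; rewrite mem_filter => /andP[/= kl _].
  by exists (unitB K ord0 k l); rewrite // om_unitB ?oner_neq0.
exists B; apply: mon_neq0 => i j _ _ ij _; apply: (hB (i, j)).
by rewrite mem_filter mem_enum andbT /=; apply: contraTneq ij => ->; rewrite ltnn.
Qed.

Lemma mon_dead (e : I -> I -> nat) D D' h (B : 'M[K]_(m, h + h)) : D \subset D' ->
  (forall i j, e i j = e j i) -> (forall i j, i \in D' -> e i j = 0%N) ->
  mon e D B = mon e D' B.
Proof.
move=> sD esym e0; rewrite /mon big_mkcond [RHS]big_mkcond; apply: eq_bigr => i _.
case: (boolP (i \in D')) => [iD'|iD'].
  case: (i \in D) => //=; rewrite big1 // => j _; by rewrite e0 // expr0.
have -> /= : i \notin D by apply: contraNN iD'; apply: (subsetP sD).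
rewrite big_mkcond [RHS]big_mkcond; apply: eq_bigr => j _.
case: (boolP (j \in D')) => [jD'|jD'].
  by rewrite esym e0 // expr0 /=; case: ifP.
by have -> : j \notin D by apply: contraNN jD'; apply: (subsetP sD).
Qed.

(** A monomial is not identically zero on Gram matrices when at least one plane is available, so
    density cancels it. In rank 0 every Gram entry is zero, whence [h.+1]. *)
Lemma vanish_divide h (base : I -> I -> nat) ex (w : T -> I -> I -> nat) c S D :
  (forall u i j, u \in S -> ex u i j = (base i j + w u i j)%N) ->
  vanish h.+1 ex c S D -> vanish h.+1 w c S D.
Proof.
move=> exE hv B.
suff Z : forall B' : 'M[K]_(m, h.+1 + h.+1), True -> pe w c S D B' = 0 by apply: Z.
apply: (lp_zero (@linear_setT K _) (@lp_pe K m T w c S D h.+1) (@lp_mon K m base D h.+1)) => //.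
  by have [B' hB'] := mon_nonzero_exists base D h; exists B'.
move=> B' _ nz; apply: (mulfI nz); rewrite mulr0 -[RHS](hv B') /pe big_distrr.
rewrite [LHS]big_seq [RHS]big_seq; apply: eq_bigr => u uS /=.
by rewrite mulrCA -monD; congr (_ * _); apply: mon_ext => i j _ _; rewrite exE.
Qed.

(** [f x] only seeds the fold: for [x] in [s] the result is the minimum over [s]. *)
Definition min_exp (f : T -> nat) (x : T) (s : seq T) : nat :=
  foldr (fun u n => minn (f u) n) (f x) s.

Lemma min_exp_le f x s u : u \in s -> (min_exp f x s <= f u)%N.
Proof.
elim: s => //= v s IHs; rewrite inE => /predU1P[->|/IHs le]; first exact: geq_minl.
exact: leq_trans (geq_minr _ _) le.
Qed.

Lemma min_exp_attained f x s : x \in s -> exists2 u, u \in s & f u = min_exp f x s.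
Proof.
move=> xs; suff [u us <-] : exists2 u, u \in x :: s & f u = min_exp f x s.
  by exists u => //; move: us; rewrite inE => /predU1P[->|].
elim: s {xs} => [|v s [u us IHs]] /=; first by exists x; rewrite ?mem_head.
rewrite /minn; case: ifP => _; first by exists v; rewrite // !inE eqxx orbT.
by exists u => //; move: us; rewrite !inE => /orP[]->; rewrite ?orbT.
Qed.

Lemma eq_min_exp f g x s : f =1 g -> min_exp f x s = min_exp g x s.
Proof. by move=> E; elim: s => [|v s IHs] /=; rewrite E // IHs. Qed.

(** Vanishing in rank 0 forces a positive exponent on some live pair. Any such pair may serve as
    [W], and splitting off one unit of its exponent gives [q = 1]. *)
Lemma single_term_structure ex c S D : wf ex c S D -> vanish 0 ex c S D -> size S = 1%N ->
  exists W u0, matching_support ex S D 2 W u0 1.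
Proof.
case: S => [|v [|]] // Wf hv _.
have [i [j [iD jD ij vij]]] : exists i j, [/\ i \notin D, j \notin D, i != j & (0 < ex v i j)%N].
  apply: NNPP => H; have /eqP := hv 0; rewrite /pe big_seq1 mulf_eq0.
  rewrite (negPf (wf_c Wf (mem_head _ _))) /=; apply/negP; apply: mon_neq0 => i j iD jD ij vij.
  by case: H; exists i, j; split=> //; apply: contraTneq ij => ->; rewrite ltnn.
pose t x := if x == i then j else i.
have ji : j == i = false by rewrite eq_sym (negPf ij).
have tij : matching [set i; j] t.
  by move=> x; rewrite !inE => /orP[]/eqP->; rewrite /t ?eqxx ?ji ?eqxx ?orbT; split;
    rewrite // 1?eq_sym // ji.
pose d x y := ((x \in [set i; j]) && (t x == y)) : nat.
have dle x y : (d x y <= ex v x y)%N.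
  rewrite /d; case: (boolP (x \in _)) => //=; rewrite !inE /t => /orP[]/eqP->.
    by rewrite eqxx; case: eqP => // <-.
  by rewrite ji; case: eqP => // <-; rewrite (wf_sym Wf).
have E x y : ex v x y = ((ex v x y - d x y) + 1 * d x y)%N by rewrite mul1n subnK.
exists [set i; j], (fun x y => ex v x y - d x y)%N; split=> //.
- by rewrite cards2 ij.
- by move=> x; rewrite !inE => /orP[]/eqP->.
- by move=> u; rewrite inE => /eqP->; exists t.
- move=> t' mt'; exists v; first exact: mem_head.
  have tt' x : x \in [set i; j] -> t' x = t x.
    move=> xW; have [] := mt' x xW; move: xW; rewrite !inE /t => /orP[]/eqP->.
      by move=> /orP[]/eqP->; rewrite ?eqxx.
    by move=> /orP[]/eqP->; rewrite ?eqxx // ji.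
  move=> x y; rewrite {1}E; congr (_ + 1 * _)%N; rewrite /d.
  by case: (boolP (x \in _)) => //= xW; rewrite tt'.
Qed.

(* Dividing by the greatest common monomial reduces to [reduced_structure]. *)
Lemma extremal_structure h ex c S D : wf ex c S D -> vanish h ex c S D ->
  size S = dfact (h.*2.+1) -> exists W u0 q, matching_support ex S D h.+1.*2 W u0 q.
Proof.
elim: h ex c S D => [|h IH] ex c S D Wf hv szS; first by
  have [W [u0 H]] := single_term_structure Wf hv szS; exists W, u0, 1%N.
have [x xS] : exists x, x \in S.
  by case: S szS {Wf hv} => [|x S] sz; [have := dfact_gt0 (h.+1.*2.+1); rewrite -sz | exists x; rewrite mem_head].
pose base i j := min_exp (fun u => ex u i j) x S.
pose w u i j := (ex u i j - base i j)%N.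
have baseC i j : base i j = base j i by apply: eq_min_exp => u; apply: (wf_sym Wf).
have exE u i j : u \in S -> ex u i j = (base i j + w u i j)%N.
  by move=> uS; rewrite subnKC //; apply: min_exp_le.
have wmin i j : exists2 u, u \in S & w u i j = 0%N.
  have [u uS E] := min_exp_attained (fun u => ex u i j) xS.
  by exists u => //; rewrite /w E subnn.
have wsym u i j : w u i j = w u j i by rewrite /w (wf_sym Wf) baseC.
have wdiag u i : w u i i = 0%N by rewrite /w (wf_diag Wf).
have wD0 u i j : u \in S -> i \in D -> w u i j = 0%N.
  move=> uS iD; have [v vS v0] := wmin i j.
  by rewrite -v0 /w (wf_agree Wf uS vS).
(* Rows left without exponents by the division become dead, so that every live row is used. *)
pose D' := [set i | all (fun u => [forall j, w u i j == 0%N]) S].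
have wD u i j : u \in S -> i \in D' -> w u i j = 0%N.
  by move=> uS; rewrite inE => /allP/(_ u uS)/forallP/(_ j)/eqP.
have sD : D \subset D'.
  apply/subsetP => i iD; rewrite inE; apply/allP => u uS; apply/forallP => j.
  by rewrite wD0.
have Wf' : wf w c S D'.
  split=> //.
  - exact: (wf_uniq Wf).
  - by move=> u v uS vS E; apply: (wf_inj Wf) => // i j; rewrite !exE // E.
  - exact: (wf_c Wf).
  - by move=> u v uS vS i j iD; rewrite !wD.
have hv' : vanish h.+1 w c S D'.
  move=> B; have -> : pe w c S D' B = pe w c S D B.
    rewrite /pe big_seq [RHS]big_seq; apply: eq_bigr => u uS; congr (_ * _).
    by rewrite (mon_dead B sD) // => i j; apply: wD.
  exact: (vanish_divide (base := base) exE hv).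
have row_used o : o \notin D' -> exists2 u, u \in S & exists j, (0 < w u o j)%N.
  rewrite inE => /allPn[u uS /forallPn[j uj]]; exists u => //.
  by exists j; rewrite lt0n.
have [W [q [cW dW q0 memS allS]]] :=
  reduced_structure Wf' hv' szS wD wmin row_used (IH w).
exists W, base, q; split=> //.
- by move=> y yW; apply: contraNN (dW y yW); apply: (subsetP sD).
- by move=> v vS; have [t tW ht] := memS v vS; exists t => // i j; rewrite exE // ht.
- by move=> t tW; have [v vS hvt] := allS t tW; exists v => // i j; rewrite exE // hvt.
Qed.

End Reduction.

(** * Permutations and perfect matchings *)

Lemma sorted_enum_ord m (W : {set 'I_m}) : sorted (fun i j : 'I_m => (i < j)%N) (enum W).
Proof.
rewrite /enum_mem -enumT.
apply: sorted_filter; first by move=> y x z; apply: ltn_trans.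
by have := iota_ltn_sorted 0 m; rewrite -val_enum_ord sorted_map.
Qed.

Lemma enum_val_mono m n (W : {set 'I_m}) (e : n = #|W|) (i j : 'I_n) :
  (enum_val (cast_ord e i) < enum_val (cast_ord e j))%N = (i < j)%N.
Proof.
have sz : size (enum W) = n by rewrite e -cardE.
have H (x y : 'I_n) : (x < y)%N -> (enum_val (cast_ord e x) < enum_val (cast_ord e y))%N.
  move=> xy; rewrite /enum_val [X in (_ < nat_of_ord X)%N](set_nth_default (enum_default (cast_ord e x)));
    last by rewrite sz /= ltn_ord.
  have tr : transitive (fun i j : 'I_m => (i < j)%N) by move=> ? ? ?; apply: ltn_trans.
  by apply: (sorted_ltn_nth tr _ (sorted_enum_ord W)); rewrite ?inE ?sz /= ?ltn_ord.
apply/idP/idP; last exact: H.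
by case: (ltngtP i j) => // [/H|/val_inj->]; rewrite ?ltnn // => h1 /(ltn_trans h1); rewrite ltnn.
Qed.

Section Positions.
Variable k : nat.
Notation pos := 'I_(k.*2).

Definition pp (x : pos) : pos := Ordinal (partner_lt (ltn_ord x)).

Lemma half_lt (x : pos) : (x./2 < k)%N.
Proof. by rewrite ltn_half_double. Qed.

Definition pair_of (x : pos) : 'I_k := Ordinal (half_lt x).

Lemma ppK : involutive pp.
Proof. by move=> x; apply: val_inj; apply: partnerK. Qed.

Lemma pp_neq x : pp x != x.
Proof. by rewrite -val_eqE partner_neq. Qed.

Lemma pp_ev i : pp (ev i) = od i.
Proof. by apply: val_inj; rewrite /= /partner odd_double. Qed.

Lemma pp_od i : pp (od i) = ev i.
Proof. by rewrite -pp_ev ppK. Qed.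

Lemma posP x : (x = ev (pair_of x) /\ ~~ odd x) \/ (x = od (pair_of x) /\ odd x).
Proof.
by case: (boolP (odd x)) => ox; [right | left]; split=> //; apply: val_inj => /=; lia.
Qed.

Lemma pair_of_ev i : pair_of (ev i) = i.
Proof. by apply: val_inj; rewrite /= doubleK. Qed.

Lemma pair_of_od i : pair_of (od i) = i.
Proof. by apply: val_inj; rewrite /= uphalf_double. Qed.

Lemma pair_of_pp x : pair_of (pp x) = pair_of x.
Proof.
by have [[E _]|[E _]] := posP x; rewrite {1}E ?pp_ev ?pp_od ?pair_of_ev ?pair_of_od.
Qed.

Lemma pair_of_eq x y : (pair_of x == pair_of y) = (y == x) || (y == pp x).
Proof.
apply/eqP/orP => [E|[/eqP->|/eqP->]] //; last by rewrite pair_of_pp.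
have [[Ex _]|[Ex _]] := posP x; have [[Ey _]|[Ey _]] := posP y;
  rewrite Ex Ey E ?pp_ev ?pp_od ?eqxx; by [left | right].
Qed.

Lemma odd_ev i : odd (ev i : pos) = false. Proof. exact: odd_double. Qed.
Lemma odd_od i : odd (od i : pos). Proof. by rewrite /= odd_double. Qed.

Lemma odd_pp x : odd (pp x) = ~~ odd x.
Proof.
have [[E ox]|[E ox]] := posP x; rewrite ?ox ?(negPf ox) E.
  by rewrite pp_ev odd_od.
by rewrite pp_od odd_ev.
Qed.

Lemma big_pairs (R : Type) (idx : R) (op : Monoid.com_law idx) (G : pos -> R) :
  \big[op/idx]_x G x = \big[op/idx]_(i < k) op (G (ev i)) (G (od i)).
Proof.
rewrite (reindex (fun p : 'I_k * bool => if p.2 then od p.1 else ev p.1)) /=.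
  rewrite -(pair_bigA _ (fun i b => G (if b then od i else ev i))) /=.
  by apply: eq_bigr => i _; rewrite big_bool Monoid.mulmC.
exists (fun x => (pair_of x, odd x)) => [[i []]|x] _ /=.
- by rewrite pair_of_od odd_double.
- by rewrite pair_of_ev odd_double.
- by have [[E /negPf->]|[E ->]] := posP x.
Qed.

(* The involution matching the value at position [2i] with the one at [2i+1]. *)
Definition perm_mate (s : 'S_(k.*2)) (x : pos) : pos := s (pp ((s^-1)%g x)).

Lemma perm_mateE s x : perm_mate s (s x) = s (pp x).
Proof. by rewrite /perm_mate permK. Qed.

Lemma pf_permP (s : 'S_(k.*2)) : pf_perm s ->
  (forall i, (s (ev i) < s (od i))%N) /\ {mono (fun i => s (ev i)) : i j / (i < j)%N}.
Proof.
move=> /andP[/forallP h1 /forallP h2]; split=> // i j.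
have H (x y : 'I_k) : (x < y)%N -> (s (ev x) < s (ev y))%N.
  by move=> xy; have /forallP/(_ y)/implyP/(_ xy) := h2 x.
apply/idP/idP; last exact: H.
by case: (ltngtP i j) => // [/H|/val_inj->]; rewrite ?ltnn // => l1 /(ltn_trans l1); rewrite ltnn.
Qed.

Lemma pf_perm_lt s : pf_perm s -> forall x, (s x < s (pp x))%N = ~~ odd x.
Proof.
move=> /pf_permP[h1 _] x; have [[E o]|[E o]] := posP x; rewrite ?o ?(negPf o) E ?pp_ev ?pp_od ?h1 //.
by apply/negbTE; rewrite -leqNgt ltnW.
Qed.

(** The values at even positions are the left ends of the pairs in increasing order, which the
    matching determines; the values at odd positions follow. *)
Lemma pf_perm_inj (s1 s2 : 'S_(k.*2)) : pf_perm s1 -> pf_perm s2 ->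
  perm_mate s1 =1 perm_mate s2 -> s1 = s2.
Proof.
move=> p1 p2 E.
pose l (s : 'S_(k.*2)) := [seq s (ev i) | i <- enum 'I_k].
have mem_l s x : pf_perm s -> (x \in l s) = (x < perm_mate s x)%N.
  move=> p; rewrite -[x](permKV s x) perm_mateE pf_perm_lt //; set y := (s^-1)%g x.
  apply/mapP/idP => [[i _ /perm_inj->]|oy]; first by rewrite odd_ev.
  exists (pair_of y); first by rewrite mem_enum.
  by have [[<-]|[_ oy']] := posP y; rewrite // oy' in oy.
have sorted_l s : pf_perm s -> sorted (fun x y : pos => (x < y)%N) (l s).
  move=> /pf_permP[_ h]; rewrite sorted_map.
  rewrite (eq_sorted (e' := fun x y : 'I_k => (x < y)%N)); last by move=> i j; apply: h.
  by have := iota_ltn_sorted 0 k; rewrite -val_enum_ord sorted_map.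
have L : l s1 = l s2.
  apply: (@irr_sorted_eq _ (fun x y : pos => (x < y)%N)).
  - by move=> ? ? ?; apply: ltn_trans.
  - by move=> ?; apply: ltnn.
  - exact: sorted_l.
  - exact: sorted_l.
  - by move=> x; rewrite !mem_l // E.
have Eev i : s1 (ev i) = s2 (ev i).
  by have /eq_in_map/(_ i) := L; rewrite mem_enum; apply.
apply/permP => x; have [[-> _]|[-> _]] := posP x; first exact: Eev.
by rewrite -pp_ev -!perm_mateE Eev.
Qed.

(** Since [t] exchanges left and right ends, there are [k] left ends. List them increasingly at the
    even positions, each followed by its image. *)
Lemma pf_perm_exists (t : pos -> pos) : involutive t -> (forall x, t x != x) ->
  exists2 s : 'S_(k.*2), pf_perm s & perm_mate s =1 t.
Proof.
move=> tK tx; pose W := [set x : pos | (x < t x)%N].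
have cW : k = #|W|.
  have E : ~: W = t @: W.
    apply/setP => x; rewrite !inE -[in RHS](tK x) mem_imset; last exact: (can_inj tK).
    by rewrite inE tK -leqNgt leq_eqVlt val_eqE (negPf (tx x)).
  have := cardsC W; rewrite E card_imset ?card_ord; last exact: (can_inj tK).
  by rewrite addnn => /double_inj.
pose L i := enum_val (cast_ord cW i).
have LW i : (L i < t (L i))%N by have := enum_valP (cast_ord cW i); rewrite inE.
have Linj : injective L by move=> i j /enum_val_inj/cast_ord_inj.
pose F (x : pos) := if odd x then t (L (pair_of x)) else L (pair_of x).
have Ft x : t (F x) = F (pp x).
  by rewrite /F odd_pp pair_of_pp; case: (odd x); rewrite ?tK.
have Flt x : (F x < t (F x))%N = ~~ odd x.
  by rewrite /F; case: (odd x); rewrite ?LW // tK; apply/negbTE; rewrite -leqNgt ltnW.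
have Finj : injective F.
  move=> x y E; have o : odd x = odd y by apply: negb_inj; rewrite -!Flt E.
  have E' : pair_of x = pair_of y.
    by move: E; rewrite /F -o; case: (odd x) => [/(can_inj tK)|] /Linj.
  have [[Ex ox]|[Ex ox]] := posP x; have [[Ey oy]|[Ey oy]] := posP y.
  - by rewrite Ex Ey E'.
  - by move: ox; rewrite o oy.
  - by move: oy; rewrite -o ox.
  - by rewrite Ex Ey E'.
exists (perm Finj).
  apply/andP; split; apply/forallP => i.
    by rewrite !permE -pp_ev -Ft Flt odd_ev.
  apply/forallP => j; apply/implyP => ij.
  by rewrite !permE /F !odd_ev !pair_of_ev enum_val_mono.
move=> x; rewrite -[x](permKV (perm Finj) x) perm_mateE.
by rewrite !permE -Ft.
Qed.

End Positions.

(** * Signs of the coefficients *)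

Section Signs.
Variables (m h : nat).
Notation I := 'I_m.
Notation pos := 'I_(h.+1.*2).
Variables (g : pos -> I) (W : {set I}).
Hypothesis gmono : {mono g : a b / (a < b)%N}.
Hypothesis gW : W = [set g a | a in pos].

Lemma g_inj : injective g.
Proof.
move=> a b E; apply: val_inj; have := gmono b a; have := gmono a b.
by rewrite E ltnn; case: ltngtP.
Qed.

Lemma gWP x : reflect (exists a, x = g a) (x \in W).
Proof. by rewrite gW; apply: (iffP imsetP) => [[a _ ->]|[a ->]]; exists a. Qed.

Lemma mem_gW a : g a \in W. Proof. by apply/gWP; exists a. Qed.

Definition mate_of (s : 'S_(h.+1.*2)) (x : I) : I :=
  if [pick a | g a == x] is Some a then g (perm_mate s a) else x.

Lemma mate_ofE s a : mate_of s (g a) = g (perm_mate s a).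
Proof. by rewrite /mate_of; case: pickP => [b /eqP/g_inj->|/(_ a)] //; rewrite eqxx. Qed.

Lemma mate_ofE' s a : mate_of s (g (s a)) = g (s (pp a)).
Proof. by rewrite mate_ofE perm_mateE. Qed.

Lemma mate_of_matching s : matching W (mate_of s).
Proof.
move=> x /gWP[a ->]; rewrite -[a](permKV s a) !mate_ofE' ppK; split=> //.
- exact: mem_gW.
- by rewrite (inj_eq g_inj) (inj_eq perm_inj) pp_neq.
Qed.

Lemma big_matching (R : comNzRingType) (G : I -> I -> R) q (s : 'S_(h.+1.*2)) :
  \prod_(i : I) \prod_(j : I | (i < j)%N) G i j ^+ (q * ((i \in W) && (mate_of s i == j))) =
  \prod_(i < h.+1) (if (s (ev i) < s (od i))%N then G (g (s (ev i))) (g (s (od i)))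
                    else G (g (s (od i))) (g (s (ev i)))) ^+ q.
Proof.
pose F (i : I) := if (i \in W) && (i < mate_of s i)%N then G i (mate_of s i) ^+ q else 1.
transitivity (\prod_i F i).
  apply: eq_bigr => i _; rewrite /F; case: (boolP (i \in W)) => iW /=; last first.
    by rewrite big1 // => j _; rewrite muln0.
  case: ifP => im.
    rewrite (bigD1 (mate_of s i)) //= eqxx muln1 big1 ?mulr1 // => j /andP[_ jm].
    by rewrite eq_sym (negPf jm) muln0.
  rewrite big1 // => j ij; case: eqP => [E|]; last by rewrite muln0.
  by rewrite E ij in im.
transitivity (\prod_(i in W) F i).
  rewrite [RHS]big_mkcond; apply: eq_bigr => i _; rewrite /F.
  by case: (boolP (i \in W)).
rewrite gW big_imset /=; last by move=> a b _ _; apply: g_inj.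
rewrite (reindex_inj (@perm_inj _ s)) /= big_pairs; apply: eq_bigr => i _.
rewrite /F !mem_gW !mate_ofE' pp_ev pp_od !gmono /=.
case: (ltngtP (s (ev i)) (s (od i))) => [_|_|/val_inj/perm_inj E].
- by rewrite mulr1.
- by rewrite mul1r.
- by have := odd_od i; rewrite -E odd_ev.
Qed.

Lemma perm_mate_tperm (s : 'S_(h.+1.*2)) c d x :
  perm_mate (tperm c d * s)%g (s x) = s (tperm c d (pp (tperm c d x))).
Proof.
have -> : s x = (tperm c d * s)%g (tperm c d x) by rewrite permM tpermK.
by rewrite perm_mateE permM.
Qed.

Section Coefficients.
Variables (K : closedFieldType) (T : eqType) (e : T -> I -> I -> nat) (c : T -> K).
Variables (S : seq T) (q : nat) (x0 : T).
Hypothesis q_gt0 : (0 < q)%N.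
Hypothesis uniqS : uniq S.
Hypothesis c_neq0 : {in S, forall v, c v != 0}.
Hypothesis e_inj : {in S &, forall u v, (forall i j, e u i j = e v i j) -> u = v}.
Hypothesis e_mem : forall v, v \in S -> exists2 t, matching W t &
  forall i j, e v i j = (q * ((i \in W) && (t i == j)))%N.
Hypothesis e_all : forall t, matching W t -> exists2 v, v \in S &
  forall i j, e v i j = (q * ((i \in W) && (t i == j)))%N.
(** The exponents [e] arise by cancelling the common monomial, which requires positive rank. *)
Hypothesis e_vanish : (0 < h)%N -> vanish h e c S set0.

(** Defined for all permutations, not only normalized ones, so that it can be followed along
    transpositions. By [e_all] the default [x0] is never reached. *)
Definition term_of (s : 'S_(h.+1.*2)) : T :=
  head x0 [seq v <- S | [forall i, forall j, e v i j == (q * ((i \in W) && (mate_of s i == j)))%N]].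

Lemma term_ofP s : term_of s \in S /\
  forall i j, e (term_of s) i j = (q * ((i \in W) && (mate_of s i == j)))%N.
Proof.
have [v vS hv] := e_all (mate_of_matching s).
pose p v := [forall i, forall j, e v i j == (q * ((i \in W) && (mate_of s i == j)))%N].
have : has p S.
  by apply/hasP; exists v => //; apply/forallP => i; apply/forallP => j; rewrite hv.
rewrite /term_of -/p has_filter; case E: (filter p S) => [//|u l] _ /=.
have : u \in filter p S by rewrite E mem_head.
rewrite mem_filter => /andP[/forallP pu ->]; split=> // i j.
by have /forallP/(_ j)/eqP := pu i.
Qed.

Lemma term_of_mem s : term_of s \in S. Proof. by have [] := term_ofP s. Qed.
Lemma term_ofE s i j : e (term_of s) i j = (q * ((i \in W) && (mate_of s i == j)))%N.
Proof. by have [_ ->] := term_ofP s. Qed.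

Lemma term_of_eq v t s : v \in S ->
  (forall i j, e v i j = (q * ((i \in W) && (t i == j)))%N) ->
  (forall x, t (g x) = g (perm_mate s x)) -> term_of s = v.
Proof.
move=> vS ht E; apply: e_inj => //; first exact: term_of_mem.
move=> i j; rewrite term_ofE ht; case: (boolP (i \in W)) => //= /gWP[a ->].
by rewrite mate_ofE E.
Qed.

Lemma term_of_inj s s' : term_of s = term_of s' -> perm_mate s =1 perm_mate s'.
Proof.
move=> E x; apply: g_inj; rewrite -!mate_ofE; apply/esym/eqP.
have := term_ofE s (g x) (mate_of s (g x)).
rewrite E term_ofE mem_gW eqxx muln1 /=; case: eqP => //= _.
by rewrite muln0 => /esym/eqP q0; move: q_gt0; rewrite lt0n q0.
Qed.

Lemma term_of_mate s s' : perm_mate s =1 perm_mate s' -> term_of s = term_of s'.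
Proof.
move=> E; apply: (term_of_eq (term_of_mem s') (term_ofE s')) => x.
by rewrite mate_ofE E.
Qed.

Lemma term_of_surj v : v \in S -> exists2 s, pf_perm s & term_of s = v.
Proof.
move=> vS; have [t tW ht] := e_mem vS.
have ex_b a : exists b, g b == t (g a).
  by have [/gWP[b ->] _ _] := tW _ (mem_gW a); exists b.
pose tau a := xchoose (ex_b a).
have tauE a : g (tau a) = t (g a) by apply/eqP/(xchooseP (ex_b a)).
have tauK : involutive tau.
  by move=> a; apply: g_inj; rewrite !tauE; have [] := tW _ (mem_gW a).
have tau_neq a : tau a != a.
  by rewrite -(inj_eq g_inj) tauE; have [] := tW _ (mem_gW a).
have [s ps hs] := pf_perm_exists tauK tau_neq.
by exists s => //; apply: (term_of_eq vS ht) => x; rewrite hs tauE.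
Qed.

Definition order_sign (x y : pos) : K := (-1) ^+ (y < x)%N.

(** The coefficient relative to the pairs in the order in which [s] lists them. The aim is that it
    alternates in [s], as the signs of a Pfaffian do. *)
Definition signed_coef (s : 'S_(h.+1.*2)) : K :=
  c (term_of s) * \prod_(i < h.+1) order_sign (s (ev i)) (s (od i)) ^+ q.

Lemma signed_coef_pf s : pf_perm s -> signed_coef s = c (term_of s).
Proof.
move=> /pf_permP[h1 _]; rewrite /signed_coef big1 ?mulr1 // => i _.
by rewrite /order_sign ltnNge ltnW // expr0 expr1n.
Qed.

Lemma signed_coef_neq0 s : signed_coef s != 0.
Proof.
rewrite mulf_neq0 ?c_neq0 ?term_of_mem //; apply/prodf_neq0 => i _.
by rewrite expf_neq0 // signr_eq0.
Qed.

Lemma order_signC (x y : pos) : x != y -> order_sign x y = - order_sign y x.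
Proof.
by rewrite /order_sign -val_eqE /=; case: ltngtP => // _ _; rewrite expr0 expr1 opprK.
Qed.

Lemma term_eval s (B : 'M[K]_(m, h + h)) :
  c (term_of s) * mon (e (term_of s)) set0 B =
  signed_coef s * \prod_(i < h.+1) om B (g (s (ev i))) (g (s (od i))) ^+ q.
Proof.
rewrite /signed_coef -mulrA; congr (_ * _).
transitivity (\prod_(i : I) \prod_(j : I | (i < j)%N)
    om B i j ^+ (q * ((i \in W) && (mate_of s i == j)))).
  rewrite /mon; apply: eq_big => [i|i _]; first by rewrite inE.
  by apply: eq_big => [j|j _]; [rewrite inE | rewrite term_ofE].
rewrite big_matching -big_split; apply: eq_bigr => i _ /=.
rewrite -exprMn; congr (_ ^+ _); rewrite /order_sign.
case: (ltngtP (s (ev i)) (s (od i))) => [_|_|/val_inj/perm_inj E].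
- by rewrite expr0 mul1r.
- by rewrite expr1 mulN1r -om_anti.
- by have := odd_od i; rewrite -E odd_ev.
Qed.

Definition wedge (u v : K * K) : K := u.1 * v.2 - u.2 * v.1.

(* Four rows in a common plane and the other pairs in orthogonal hyperbolic planes leave only the
   three matchings that differ from [s] on those four rows. *)
Lemma three_term_relation s a b (vA vB vC vD : K * K) : pair_of a != pair_of b ->
  signed_coef s * (wedge vA vB * wedge vC vD) ^+ q +
  signed_coef (tperm a b * s)%g * (wedge vA vC * wedge vB vD) ^+ q +
  signed_coef (tperm a (pp b) * s)%g * (wedge vA vD * wedge vC vB) ^+ q = 0.
Proof.
move=> pab.
have h0 : (0 < h)%N.
  by case: (h) a b pab => // a b; rewrite !ord1 eqxx.
have := pab; rewrite pair_of_eq negb_or => /andP[nba nbpa].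
have nab : a != b by rewrite eq_sym.
have napb : a != pp b by apply: contraNneq nbpa => ->; rewrite ppK.
have npapb : pp a != pp b by rewrite (inj_eq (can_inj (@ppK _))).
have npab : pp a != b by rewrite eq_sym.
have npbb := pp_neq b.
have nbpb : b != pp b by rewrite eq_sym.
have npba : pp b != a by rewrite eq_sym.
have npbpa : pp b != pp a by rewrite eq_sym.
have pba : pair_of b != pair_of a by rewrite eq_sym.
have [k0 k0E k0U] := unlift_some pba.
(* There are [h] planes for [h.+1] pairs: the pairs of [a] and [b] share plane [k0], and each other
   pair gets its own. *)
pose phi i : 'I_h := odflt k0 (unlift (pair_of b) i).
pose F x := (pair_of x == pair_of a) || (pair_of x == pair_of b).
have phi_eq x y : phi (pair_of x) = phi (pair_of y) -> F x || (pair_of x == pair_of y).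
  rewrite /phi /F; case: unliftP => [i ->|->]; last by rewrite eqxx orbT.
  case: unliftP => [j ->|->] /= => [->|->]; first by rewrite eqxx orbT.
  by rewrite k0E eqxx.
have phiF x : F x -> phi (pair_of x) = k0.
  by rewrite /F /phi => /orP[]/eqP->; rewrite ?k0U ?unlift_none.
have pair_eq x d : (pair_of x == pair_of d) = (x == d) || (x == pp d).
  by rewrite eq_sym pair_of_eq.
have FP x : F x -> [|| x == a, x == pp a, x == b | x == pp b].
  by rewrite /F !pair_eq -orbA.
pose vec x : K * K := if x == pp a then vA else if x == a then vB else if x == b then vC
  else if x == pp b then vD else if odd x then (0, 1) else (1, 0).
have vecA : vec (pp a) = vA by rewrite /vec eqxx.
have vecB : vec a = vB by rewrite /vec eq_sym (negPf (pp_neq a)) eqxx.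
have vecC : vec b = vC by rewrite /vec (negPf nbpa) (negPf nba) eqxx.
have vecD : vec (pp b) = vD.
  by rewrite /vec (negPf npbpa) (negPf npba) (negPf (pp_neq b)) eqxx.
have vecF x : ~~ F x -> vec x = if odd x then (0, 1) else (1, 0).
  rewrite /F !pair_eq !negb_or /vec.
  by move=> /andP[/andP[/negPf-> /negPf->] /andP[/negPf-> /negPf->]].
pose row (r : I) := [pick x | g (s x) == r].
have rowE x : row (g (s x)) = Some x.
  by rewrite /row; case: pickP => [y /eqP/g_inj/perm_inj->|/(_ x)] //; rewrite eqxx.
pose B : 'M[K]_(m, h + h) := mkPQ
  (fun r l => if row r is Some x then (l == phi (pair_of x))%:R * (vec x).1 else 0)
  (fun r l => if row r is Some x then (l == phi (pair_of x))%:R * (vec x).2 else 0).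
have omE x y : om B (g (s x)) (g (s y)) =
    (phi (pair_of x) == phi (pair_of y))%:R * wedge (vec x) (vec y).
  rewrite om_mkPQ !rowE (bigD1 (phi (pair_of x))) //= eqxx big1 ?addr0; last first.
    by move=> l /negPf->; rewrite !mul0r subrr.
  by case: eqP => _; rewrite /wedge !(mul1r, mul0r, mulr0, subr0).
have four v : v \in S -> mon (e v) set0 B != 0 ->
    v \in [:: term_of s; term_of (tperm a b * s)%g; term_of (tperm a (pp b) * s)%g].
  move=> vS nz; have [t tW ht] := e_mem vS.
  (* The matching of [v] read on the positions of [s]. A nonzero value at [B] keeps it within the
     planes, so it agrees with [pp] outside [F] and pairs the four positions of [F] among
     themselves. *)
  pose R x y := t (g (s x)) = g (s y).
  have Rtot x : exists y, R x y.
    have [/gWP[z Ez] _ _] := tW _ (mem_gW (s x)).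
    by exists ((s^-1)%g z); rewrite /R permKV.
  have Rsym x y : R x y -> R y x.
    by rewrite /R => <-; have [] := tW _ (mem_gW (s x)).
  have Rfun x y z : R x y -> R x z -> y = z.
    by rewrite /R => -> /g_inj/perm_inj.
  have Rirr x : ~ R x x by move=> E; have [_] := tW _ (mem_gW (s x)); rewrite E eqxx.
  have Rphi x y : R x y -> phi (pair_of x) = phi (pair_of y).
    move=> Rxy; apply/eqP; apply: contraNT nz => nphi; apply/eqP.
    have [_ txx _] := tW _ (mem_gW (s x)).
    apply: (@mon_eq0 _ _ _ _ _ _ (g (s x)) (g (s y))); rewrite ?inE //.
    - by rewrite -Rxy eq_sym.
    - by move=> i j; rewrite !ht (matching_sym _ _ tW).
    - by rewrite ht mem_gW Rxy eqxx muln1.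
    - by rewrite omE (negPf nphi) mul0r.
  have Rout x : ~~ F x -> R x (pp x).
    move=> Fx; have [y Rxy] := Rtot x.
    have := phi_eq _ _ (Rphi _ _ Rxy); rewrite (negPf Fx) pair_of_eq /= => /orP[]/eqP E.
      by case: (Rirr x); rewrite -{2}E.
    by rewrite -E.
  have Rin x y : F x -> R x y -> [|| y == a, y == pp a, y == b | y == pp b].
    move=> Fx Rxy; apply: FP; apply: contraT => Fy.
    have E := Rfun _ _ _ (Rsym _ _ Rxy) (Rout _ Fy).
    by move: Fx; rewrite E /F pair_of_pp -/(F y) (negPf Fy).
  (* Exchanging [a] and [d] in [s] matches [a] with [pp d] and [d] with [pp a]; this covers [d = b]
     and [d = pp b]. *)
  have Rcase d : F d -> pp d != a -> d != a -> R a (pp d) -> R d (pp a) ->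
      term_of (tperm a d * s)%g = v.
    move=> Fd npda nda R1 R2; apply: (term_of_eq vS ht) => x.
    rewrite -[x](permKV s x) perm_mate_tperm; set w := (s^-1)%g x.
    have npad : pp a != d by apply: contraNneq npda => <-; rewrite ppK.
    have [->|wa] := eqVneq w a.
      by rewrite tpermL tpermD // eq_sym // pp_neq.
    have [->|wd] := eqVneq w d.
      by rewrite tpermR tpermD // eq_sym // pp_neq.
    rewrite [tperm a d w]tpermD 1?eq_sym //.
    have [->|wpa] := eqVneq w (pp a); first by rewrite ppK tpermL; apply: Rsym.
    have [->|wpd] := eqVneq w (pp d); first by rewrite ppK tpermR; apply: Rsym.
    have pwa : a != pp w by apply: contraNneq wpa => ->; rewrite ppK.
    have pwd : d != pp w by apply: contraNneq wpd => ->; rewrite ppK.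
    rewrite tpermD //; apply: Rout; apply/negP => /FP.
    rewrite (negPf wa) (negPf wpa) /=.
    have : [|| d == a, d == pp a, d == b | d == pp b] by apply: FP.
    rewrite (negPf nda) [d == pp a]eq_sym (negPf npad) /= => /orP[]/eqP E.
      by rewrite -E (negPf wd) (negPf wpd).
    have Eb : b = pp d by rewrite E ppK.
    by rewrite Eb ppK (negPf wpd) (negPf wd).
  have Fa : F a by rewrite /F eqxx.
  have Fpa : F (pp a) by rewrite /F pair_of_pp eqxx.
  have Fb : F b by rewrite /F eqxx orbT.
  have Fpb : F (pp b) by rewrite /F pair_of_pp eqxx orbT.
  have Rother x y x' y' : R x y -> R x' y' -> x' != x -> y' != y.
    by move=> r1 r2; apply: contraNneq => E; rewrite E in r2; rewrite (Rfun _ _ _ (Rsym _ _ r1) (Rsym _ _ r2)).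
  have [y Ray] := Rtot a; have := Rin _ _ Fa Ray; case/or4P=> /eqP Ey; subst y.
  - by case: (Rirr a).
  - have [z Rbz] := Rtot b; have Rpa := Rsym _ _ Ray.
    have := Rin _ _ Fb Rbz; case/or4P=> /eqP Ez; subst z.
    + by have := Rother _ _ _ _ Rpa Rbz nbpa; rewrite eqxx.
    + by have := Rother _ _ _ _ Ray Rbz nba; rewrite eqxx.
    + by case: (Rirr b).
    suff -> : v = term_of s by rewrite mem_head.
    apply/esym/(term_of_eq vS ht) => x; rewrite -[x](permKV s x) perm_mateE.
    set w := (s^-1)%g x; case: (boolP (F w)) => [/FP|/Rout] //.
    by case/or4P=> /eqP->; rewrite ?ppK //; apply: Rsym.
  - have [z Rz] := Rtot (pp a); have Rb := Rsym _ _ Ray.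
    have := Rin _ _ Fpa Rz; case/or4P=> /eqP Ez; subst z.
    + by have := Rother _ _ _ _ Rb Rz npab; rewrite eqxx.
    + by case: (Rirr (pp a)).
    + by have := Rother _ _ _ _ Ray Rz (pp_neq a); rewrite eqxx.
    by rewrite -(Rcase (pp b)) ?ppK ?inE ?eqxx ?orbT //; apply: Rsym.
  - have [z Rz] := Rtot b; have Rb := Rsym _ _ Ray.
    have := Rin _ _ Fb Rz; case/or4P=> /eqP Ez; subst z.
    + by have := Rother _ _ _ _ Rb Rz; rewrite eq_sym pp_neq eqxx => /(_ isT).
    + by rewrite -(Rcase b) ?inE ?eqxx ?orbT.
    + by case: (Rirr b).
    + by have := Rother _ _ _ _ Ray Rz nba; rewrite eqxx.
(* The sign for listing a pair as [pp x], [x] instead of even position first. It contributes the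
   same nonzero factor to the three terms. *)
pose eta x : K := (-1) ^+ (~~ odd x).
have pair_om (s' : 'S_(h.+1.*2)) (x : pos) :
    om B (g (s' (ev (pair_of x)))) (g (s' (od (pair_of x)))) =
    eta x * om B (g (s' (pp x))) (g (s' x)).
  rewrite /eta; have [[E o]|[E o]] := posP x.
    have E2 : pp x = od (pair_of x) by rewrite {1}E pp_ev.
    by rewrite o expr1 mulN1r -om_anti E2 -E.
  have E2 : pp x = ev (pair_of x) by rewrite {1}E pp_od.
  by rewrite o expr0 mul1r E2 -E.
have prodE (s' : 'S_(h.+1.*2)) : (forall x, ~~ F x -> s' x = s x) ->
    \prod_(i < h.+1) om B (g (s' (ev i))) (g (s' (od i))) ^+ q =
    (eta a * eta (pp b)) ^+ q *
      (om B (g (s' (pp a))) (g (s' a)) * om B (g (s' b)) (g (s' (pp b)))) ^+ q.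
  move=> Hs'; rewrite (bigD1 (pair_of a)) //= (bigD1 (pair_of b)) //= big1 ?mulr1; last first.
    move=> i /andP[ia ib].
    have F1 : ~~ F (ev i) by rewrite /F pair_of_ev negb_or ia.
    have F2 : ~~ F (od i) by rewrite /F pair_of_od negb_or ia.
    rewrite !Hs' // omE !vecF // odd_ev odd_od pair_of_ev pair_of_od eqxx mul1r.
    by rewrite /wedge /= mulr1 mul0r subr0 expr1n.
  rewrite (pair_om s' a) -(pair_of_pp b) (pair_om s' (pp b)) ppK -!exprMn; congr (_ ^+ _).
  by ring.
have Ft d x : F d -> ~~ F x -> (tperm a d * s)%g x = s x.
  move=> Fd Fx; rewrite permM tpermD //; apply: contraNneq Fx => <- //.
  by rewrite /F eqxx.
have phi0 x y : F x -> F y -> om B (g (s x)) (g (s y)) = wedge (vec x) (vec y).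
  by move=> Fx Fy; rewrite omE !phiF // eqxx mul1r.
have Fa : F a by rewrite /F eqxx.
have Fpa : F (pp a) by rewrite /F pair_of_pp eqxx.
have Fb : F b by rewrite /F eqxx orbT.
have Fpb : F (pp b) by rewrite /F pair_of_pp eqxx orbT.
pose s2 := (tperm a b * s)%g; pose s3 := (tperm a (pp b) * s)%g.
have n12 : term_of s != term_of s2.
  apply/eqP => /term_of_inj/(_ (s a)); rewrite perm_mateE perm_mate_tperm tpermL.
  by rewrite tpermD // => /perm_inj/eqP; rewrite (negPf npapb).
have n13 : term_of s != term_of s3.
  apply/eqP => /term_of_inj/(_ (s a)); rewrite perm_mateE perm_mate_tperm tpermL ppK.
  by rewrite tpermD // => /perm_inj/eqP; rewrite (negPf npab).
have n23 : term_of s2 != term_of s3.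
  apply/eqP => /term_of_inj/(_ (s a)); rewrite !perm_mate_tperm !tpermL ppK.
  rewrite tpermD // tpermD // => /perm_inj/eqP; rewrite (negPf (pp_neq b)) //.
have E : \sum_(v <- [:: term_of s; term_of s2; term_of s3]) c v * mon (e v) set0 B = 0.
  rewrite -[RHS](e_vanish h0 B) /pe [RHS](bigID (mem [:: term_of s; term_of s2; term_of s3])) /=.
  rewrite [X in _ = _ + X]big_seq_cond [X in _ = _ + X]big1 ?addr0; last first.
    move=> v /andP[vS vn]; case: (eqVneq (mon (e v) set0 B) 0) => [->|nz]; rewrite ?mulr0 //.
    by rewrite (four v vS nz) in vn.
  rewrite -[RHS]big_filter; apply: perm_big; apply: uniq_perm.
  - by rewrite /= !inE negb_or n12 n13 n23.
  - exact: filter_uniq.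
  - move=> v; rewrite mem_filter; case: (boolP (v \in _)) => //=.
    by rewrite !inE => /or3P[]/eqP->; rewrite term_of_mem.
move: E; rewrite !big_cons big_nil addr0 !term_eval !prodE //; last 2 first.
- by move=> x; apply: Ft.
- by move=> x; apply: Ft.
rewrite !permM !tpermL !tpermR.
have D1 d x : a != x -> d != x -> tperm a d x = x by apply: tpermD.
rewrite (D1 b (pp a)) ?(D1 b (pp b)) ?(D1 (pp b) (pp a)) ?(D1 (pp b) b) //;
  rewrite 1?eq_sym ?pp_neq //.
rewrite !phi0 // vecA vecB vecC vecD => E.
have nz : (eta a * eta (pp b)) ^+ q != 0 by rewrite expf_neq0 // mulf_neq0 // signr_eq0.
apply: (mulfI nz); rewrite mulr0 -[RHS]E !mulrDr addrA; congr (_ + _ + _); exact: mulrCA.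
Qed.

(** With [vA = vD] and [vB = vC] the third product vanishes and the first two are equal and
    nonzero. *)
Lemma signed_coef_swap s a b : pair_of a != pair_of b ->
  signed_coef (tperm a b * s)%g = - signed_coef s.
Proof.
move=> pab; have := three_term_relation s (1, 0) (0, 1) (0, 1) (1, 0) pab.
rewrite /wedge /= !(mul0r, mulr0, mul1r, subr0, sub0r, subrr) expr0n gtn_eqF // mulr0 addr0.
rewrite -mulrDl => /eqP; rewrite mulf_eq0 expf_eq0 oppr_eq0 oner_eq0 andbF orbF addrC.
by rewrite addr_eq0 => /eqP.
Qed.

(** The four vectors are chosen so that the three products are [x + y], [x] and [y]; by the swap
    rule the three coefficients agree up to sign. *)
Lemma additive_power : (0 < h)%N -> forall x y : K, (x + y) ^+ q = x ^+ q + y ^+ q.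
Proof.
move=> h0 x y; pose a : pos := ev ord0; pose b : pos := ev ord_max.
have pab : pair_of a != pair_of b.
  by rewrite !pair_of_ev -val_eqE /= eq_sym -lt0n.
have := three_term_relation 1%g (1, 0) (0, 1) (y, 1) (- x, 1) pab.
rewrite !signed_coef_swap ?pair_of_pp // /wedge /=.
rewrite !(mul0r, mulr0, mul1r, mulr1, subr0, sub0r, opprK) !mulNr -!mulrBr => /eqP.
rewrite mulf_eq0 (negPf (signed_coef_neq0 _)) /= -addrA -opprD subr_eq0 addrC => /eqP.
by rewrite add0r.
Qed.

Hypothesis powN1 : (-1) ^+ q = -1 :> K.

(** Exchanging the two positions of one pair keeps the matching, hence the term, and reverses one
    order sign, whose [q]-th power changes sign by [powN1]. *)
Lemma signed_coef_flip s a : signed_coef (tperm a (pp a) * s)%g = - signed_coef s.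
Proof.
have E x : (tperm a (pp a) * s)%g x = s (if pair_of x == pair_of a then pp x else x).
  rewrite permM; congr (s _); rewrite eq_sym pair_of_eq.
  case: eqVneq => [->|xa]; first by rewrite tpermL.
  by case: eqVneq => [->|xpa]; rewrite ?tpermR ?ppK // tpermD // eq_sym.
rewrite /signed_coef -(term_of_mate (s := s)); last first.
  move=> x; rewrite -[x](permKV s x) perm_mate_tperm perm_mateE; congr (s _).
  set w := (s^-1)%g x; have [->|wa] := eqVneq w a.
    by rewrite tpermL ppK tpermL.
  have [->|wpa] := eqVneq w (pp a); first by rewrite tpermR tpermR ppK.
  rewrite [tperm _ _ w]tpermD 1?eq_sym // tpermD //.
    by apply: contraNneq wpa => ->; rewrite ppK.
  by rewrite (inj_eq (can_inj (@ppK _))) eq_sym.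
rewrite -mulrN; congr (_ * _); rewrite (bigD1 (pair_of a)) //= [in RHS](bigD1 (pair_of a)) //=.
rewrite !E pair_of_ev pair_of_od eqxx pp_ev pp_od -mulNr; congr (_ * _).
  rewrite order_signC; last first.
    by rewrite (inj_eq perm_inj); apply: contraTneq (odd_od (pair_of a)) => ->; rewrite odd_ev.
  by rewrite exprNn powN1 mulN1r.
apply: eq_bigr => i /negPf ia; by rewrite !E pair_of_ev pair_of_od ia.
Qed.

Lemma signed_coef_perm s : signed_coef s = (-1) ^+ s * signed_coef 1%g.
Proof.
have [ts -> _] := prod_tpermP s; elim: ts => [|[a b] ts IHts].
  by rewrite big_nil odd_perm1 expr0 mul1r.
rewrite big_cons /=; set u := (\prod_(_ <- _) _)%g in IHts *.
rewrite odd_mul_tperm; case: (eqVneq a b) => [->|ab] /=.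
  by rewrite tperm1 mul1g.
rewrite signrN mulNr -IHts; case: (eqVneq (pair_of a) (pair_of b)) => [E|]; last exact: signed_coef_swap.
by move/eqP: E; rewrite pair_of_eq eq_sym (negPf ab) => /eqP->; apply: signed_coef_flip.
Qed.

End Coefficients.
End Signs.

(** * Back to polynomials *)

(** In characteristic [p] write [q = n * p ^ e] with [n] prime to [p]. Every element of [K] is a
    [p ^ e]-th power, so [(u + 1) ^+ n = u ^+ n + 1] for all [u]. If [n > 1], comparing linear
    coefficients gives [n%:R = 0], against coprimality. In characteristic 0 the same comparison
    applies to [q]. *)
Lemma additive_exponent (K : closedFieldType) (p q : nat) : char_exp K p -> (0 < q)%N ->
  (forall x y : K, (x + y) ^+ q = x ^+ q + y ^+ q) ->
  exists2 e, q = (p ^ e)%N & q = 1%N \/ p \in [pchar K].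
Proof.
have nat0 n : (1 < n)%N -> (forall u : K, (u + 1) ^+ n = u ^+ n + 1) -> n%:R = 0 :> K.
  move=> n1 hn; pose P : {poly K} := ('X + 1) ^+ n - 'X ^+ n - 1.
  have P0 : P = 0.
    apply/eqP; apply: contraT => /closed_nonrootP[t]; rewrite /root !hornerE hn.
    by rewrite addrAC addrK addrN eqxx.
  have : P^`().[0] = 0 by rewrite P0 deriv0 horner0.
  rewrite /P !derivB !deriv_exp derivD derivX derivC addr0 subr0 !hornerE /=.
  rewrite !hornerMn !hornerE expr1n expr0n.
  by rewrite (_ : (n.-1 == 0)%N = false) ?mul0rn ?subr0 //; lia.
move=> hp q0 hq; case: hp => [pK|[-> nop]].
  have pr : prime p by apply: pcharf_prime pK.
  have [n pn qE] := pfactor_coprime pr q0.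
  exists (logn p q); last by right.
  rewrite {1}qE; suff -> : n = 1%N by rewrite mul1n.
  set e := logn p q in qE *.
  have n0 : (0 < n)%N by case: n qE {pn} => // qE; rewrite qE in q0.
  apply/eqP; rewrite eqn_leq n0 andbT leqNgt; apply/negP => n1.
  have : n%:R = 0 :> K.
    apply: nat0 => // u.
    have pe0 : (0 < p ^ e)%N by rewrite expn_gt0 prime_gt0.
    have /closed_rootP[t] : size ('X^(p ^ e) - u%:P) != 1%N by rewrite size_XnsubC //; lia.
    rewrite /root !hornerE subr_eq0 => /eqP <-.
    have hpe : (t + 1) ^+ (p ^ e) = t ^+ (p ^ e) + 1.
      rewrite exprDn_pchar ?expr1n // pnatX pnatE // pK //.
    by rewrite -hpe -!exprM mulnC -qE hq expr1n.
  move/eqP; rewrite -(dvdn_pcharf pK) => pn'.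
  by move: pn; rewrite prime_coprime // pn'.
have q1 : q = 1%N; last by exists 0%N; [rewrite q1 | left].
apply/eqP; rewrite eqn_leq q0 andbT leqNgt; apply/negP => q1.
have qK : q%:R = 0 :> K by apply: nat0 => // u; rewrite hq expr1n.
have [|p' hp'] := natf0_pchar q0 (_ : q%:R == 0 :> K); first exact/eqP.
by move: (nop p'); rewrite hp'.
Qed.

Lemma exprN1_additive (R : nzRingType) q : (0 < q)%N ->
  (forall x y : R, (x + y) ^+ q = x ^+ q + y ^+ q) -> (-1) ^+ q = -1 :> R.
Proof.
move=> q0 hq; have := hq 1 (-1); rewrite subrr expr0n gtn_eqF // expr1n => /eqP.
by rewrite eq_sym addrC addr_eq0 => /eqP.
Qed.

Lemma expr_sum_additive (R : nzRingType) q (J : Type) (s : seq J) (P : pred J) (F : J -> R) :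
  (0 < q)%N -> (forall x y : R, (x + y) ^+ q = x ^+ q + y ^+ q) ->
  (\sum_(i <- s | P i) F i) ^+ q = \sum_(i <- s | P i) F i ^+ q.
Proof.
move=> q0 hq; apply: (big_morph (fun x => x ^+ q)) => //.
by rewrite expr0n gtn_eqF.
Qed.

(** * Gram matrices and their rank *)

Section GramMatrix.
Variables (K : closedFieldType) (m h : nat).

Definition gram (B : 'M[K]_(m, h + h)) : 'M[K]_m := \matrix_(i, j) om B i j.

Definition sympJ : 'M[K]_(h + h) := block_mx 0 1%:M (- 1%:M) 0.

Lemma gramE B : gram B = B *m sympJ *m B^T.
Proof.
rewrite -[B in RHS]hsubmxK mul_row_block !mulmx0 !mulmx1 mulmxN mulmx1 add0r addr0.
rewrite tr_row_mx mul_row_col; apply/matrixP => i j; rewrite !mxE /om big_split /= addrC.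
by congr (_ + _); apply: eq_bigr => l _; rewrite !mxE ?mulNr.
Qed.

Lemma alt_skew_gram B : alt_skew (gram B).
Proof.
split; last by move=> i; rewrite mxE om_diag.
by apply/matrixP => i j; rewrite !mxE om_anti.
Qed.

Lemma rank_gram B : (\rank (gram B) <= h + h)%N.
Proof. by rewrite gramE mulmx_max_rank. Qed.

Lemma sympJ_unit : sympJ \in unitmx.
Proof.
have : sympJ *m block_mx 0 (- 1%:M) 1%:M 0 = 1%:M.
  by rewrite mulmx_block !(mul0mx, mulmx0, mul1mx, mulmx1, mulNmx, mulmxN, add0r, addr0, opprK, oppr0) -scalar_mx_block.
by case/mulmx1_unit.
Qed.

(** [pid_mx] selects the top [h + h] rows of [B]. If that block is invertible, the corresponding
    block of the Gram matrix is congruent to [sympJ], hence nonsingular. *)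
Lemma rank_gram_generic B : \det ((pid_mx (h + h) : 'M_(h + h, m)) *m B) != 0 ->
  \rank (gram B) = (h + h)%N.
Proof.
set C := pid_mx _ => hdet; apply/eqP; rewrite eqn_leq rank_gram /=.
have uCB : C *m B \in unitmx by rewrite unitmxE unitfE.
have E : C *m gram B *m C^T = (C *m B) *m sympJ *m (C *m B)^T.
  by rewrite gramE trmx_mul !mulmxA.
have : \rank (C *m gram B *m C^T) = (h + h)%N.
  by apply: mxrank_unit; rewrite E !unitmx_mul uCB sympJ_unit unitmx_tr.
move=> <-; apply: leq_trans (mxrankM_maxl _ _) _; exact: mxrankM_maxr.
Qed.

Lemma generic_rank_exists : (h + h <= m)%N ->
  exists B : 'M[K]_(m, h + h), \det ((pid_mx (h + h) : 'M_(h + h, m)) *m B) != 0.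
Proof. by move=> le; exists (pid_mx (h + h)); rewrite pid_mx_id // pid_mx_1 det1 oner_neq0. Qed.

End GramMatrix.

(** * From multivariate polynomials to sparse sums and back *)

Section Translation.
Variables (K : closedFieldType) (m : nat).
Notation I := 'I_m.

Definition edge_exp (u : 'X_{1..(m * m)}) (i j : I) : nat :=
  if (i < j)%N then u (mxvec_index i j) else if (j < i)%N then u (mxvec_index j i) else 0%N.

Definition upper_exp (u : 'X_{1..(m * m)}) : Prop :=
  forall i j : I, ~~ (i < j)%N -> u (mxvec_index i j) = 0%N.

Lemma prod_upper (R : comNzRingType) (v : 'I_(m * m) -> R) u : upper_exp u ->
  \prod_k v k ^+ u k =
  \prod_(i : I) \prod_(j : I | (i < j)%N) v (mxvec_index i j) ^+ edge_exp u i j.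
Proof.
move=> hu; transitivity (\prod_(p : I * I) v (mxvec_index p.1 p.2) ^+ u (mxvec_index p.1 p.2)).
  by rewrite (reindex _ (curry_mxvec_bij _ _)); apply: eq_bigr => -[i j].
rewrite -(pair_bigA _ (fun i j => v (mxvec_index i j) ^+ u (mxvec_index i j))) /=.
apply: eq_bigr => i _; rewrite [RHS]big_mkcond; apply: eq_bigr => j _ /=.
by rewrite /edge_exp; case: (boolP (i < j)%N) => // ij; rewrite hu.
Qed.

Lemma wf_mpoly (f : {mpoly K[m * m]}) : upper_mpoly f ->
  wf edge_exp (fun u => f@_u) (msupp f) set0.
Proof.
move=> uf; split.
- exact: msupp_uniq.
- move=> u v uf' vf' E; apply/mnmP => k; case/mxvec_indexP: k => i j.
  case: (boolP (i < j)%N) => ij; last by rewrite (uf u uf') // (uf v vf').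
  by have := E i j; rewrite /edge_exp ij.
- by move=> u; rewrite mcoeff_msupp.
- by move=> u i j; rewrite /edge_exp; case: ltngtP.
- by move=> u i; rewrite /edge_exp ltnn.
- by move=> u v _ _ i j; rewrite inE.
Qed.

Lemma eval_gram h (f : {mpoly K[m * m]}) (B : 'M[K]_(m, h + h)) : upper_mpoly f ->
  eval_mx f (gram B) = pe edge_exp (fun u => f@_u) (msupp f) set0 B.
Proof.
move=> uf; rewrite /eval_mx mevalE /pe big_seq [RHS]big_seq; apply: eq_bigr => u us.
congr (_ * _); rewrite (prod_upper _ (uf u us)) /mon; apply: eq_big => [i|i _]; first by rewrite inE.
by apply: eq_big => [j|j _]; rewrite ?inE // mxvecE mxE.
Qed.

Lemma prod_monomial (J : Type) (s : seq J) (P : pred J) (F : J -> {mpoly K[m * m]}) :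
  (forall j, P j -> exists u, F j = 'X_[u]) -> exists u, \prod_(j <- s | P j) F j = 'X_[u].
Proof.
move=> hF; apply: (big_ind (fun x => exists u, x = 'X_[u])) => [|x y [u ->] [v ->]|//]; first by exists 0%MM; rewrite mpolyX0.
by exists (u + v)%MM; rewrite mpolyXD.
Qed.

(* For [h = 0] there is no relation between terms to determine [q], so [q = 1] is chosen. *)
Lemma extremal_form h p (f : {mpoly K[m * m]}) : char_exp K p -> upper_mpoly f ->
  size (msupp f) = dfact (h.*2.+1) -> vanish h edge_exp (fun u => f@_u) (msupp f) set0 ->
  exists (c : K) (u : 'X_{1..(m * m)}) (e : nat) (g : 'I_(h.+1.*2) -> 'I_m),
    [/\ c != 0, {mono g : a b / (a < b)%N} & f = c *: 'X_[u] * (pf_sub K g) ^+ (p ^ e)].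
Proof.
move=> hp uf szf hv; have Wf := wf_mpoly uf.
have [W [u0 [q [ms hq1]]]] : exists W u0 q, matching_support edge_exp (msupp f) set0 h.+1.*2 W u0 q
    /\ (h = 0%N -> q = 1%N).
  case: (posnP h) => h0; last first.
    have [W [u0 [q ms]]] := extremal_structure Wf hv szf; exists W, u0, q; split=> // E.
    by rewrite E in h0.
  subst h.
  by have [W [u0 ms]] := single_term_structure Wf hv szf; exists W, u0, 1%N.
have [cW _ q0 memS allS] := ms.
pose g (i : 'I_(h.+1.*2)) := enum_val (cast_ord (esym cW) i).
have gmono : {mono g : a b / (a < b)%N} by move=> a b; apply: enum_val_mono.
have gW : W = [set g a | a in 'I_(h.+1.*2)].
  apply/setP => x; apply/idP/imsetP => [xW|[a _ ->]]; last exact: enum_valP.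
  by exists (cast_ord cW (enum_rank_in xW x)); rewrite // /g cast_ordK enum_rankK_in.
pose e v i j := (edge_exp v i j - u0 i j)%N.
have exE v i j : v \in msupp f -> edge_exp v i j = (u0 i j + e v i j)%N.
  by move=> /memS[t _ ht]; rewrite /e ht addKn.
have e_mem v : v \in msupp f -> exists2 t, matching W t &
    forall i j, e v i j = (q * ((i \in W) && (t i == j)))%N.
  by move=> /memS[t tW ht]; exists t => // i j; rewrite /e ht addKn.
have e_all t : matching W t -> exists2 v, v \in msupp f &
    forall i j, e v i j = (q * ((i \in W) && (t i == j)))%N.
  by move=> /allS[v vS ht]; exists v => // i j; rewrite /e ht addKn.
have e_inj : {in msupp f &, forall u v, (forall i j, e u i j = e v i j) -> u = v}.
  by move=> u v us vs E; apply: (wf_inj Wf) => // i j; rewrite !exE // E.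
have e_vanish : (0 < h)%N -> vanish h e (fun u => f@_u) (msupp f) set0.
  move=> h0; move: hv; case: (h) h0 => // n _ hv.
  by apply: (vanish_divide (base := u0) _ hv) => u i j; apply: exE.
have c_neq0 := wf_c Wf.
have uS := msupp_uniq f.
pose term := term_of g W e (msupp f) q 0%MM.
have termE : forall s i j, e (term s) i j = (q * ((i \in W) && (mate_of g s i == j)))%N.
  by move=> s i j; apply: (term_ofE gmono gW).
have term_mem s : term s \in msupp f by apply: (term_of_mem gmono gW).
have hadd : forall x y : K, (x + y) ^+ q = x ^+ q + y ^+ q.
  case: (posnP h) => h0; first by rewrite hq1.
  by apply: (additive_power gmono gW 0%MM q0 uS c_neq0 e_inj e_mem e_all e_vanish).
have [ex qE qp] := additive_exponent hp q0 hadd.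
pose R := {mpoly K[m * m]}.
(* Additivity is known on [K] only; it passes to the polynomial ring because [q] is 1 or a power of
   the characteristic. *)
have haddR (x y : R) : (x + y) ^+ q = x ^+ q + y ^+ q.
  case: qp => [->//|pK]; rewrite qE exprDn_pchar // pnatX pnatE ?(pcharf_prime pK) //.
  by rewrite pchar_lalg pK.
pose c0 := signed_coef g W e (fun u => f@_u) (msupp f) q 0%MM 1%g.
have coefE s : pf_perm s -> f@_(term s) = (-1) ^+ s * c0.
  move=> ps; rewrite -(signed_coef_perm gmono gW 0%MM q0 uS e_inj e_mem e_all e_vanish).
    by rewrite signed_coef_pf.
  exact: exprN1_additive.
have c00 : c0 != 0 by apply: (signed_coef_neq0 gmono gW).
have [U0 U0E] : exists U0, \prod_(i : I) \prod_(j : I | (i < j)%N) ('X_(mxvec_index i j) : R) ^+ u0 i j = 'X_[U0].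
  apply: prod_monomial => i _; apply: prod_monomial => j _.
  by exists (U_(mxvec_index i j) *+ u0 i j)%MM; rewrite mpolyXn.
have XE s : pf_perm s -> 'X_[term s] = 'X_[U0] *
    (\prod_(i < h.+1) genx K (g (s (ev i))) (g (s (od i)))) ^+ q :> R.
  move=> /pf_permP[ps _]; rewrite mpolyXE_id (prod_upper _ (uf _ (term_mem s))) -U0E.
  rewrite -prodrXl.
  transitivity (\prod_(i : I) \prod_(j : I | (i < j)%N) (('X_(mxvec_index i j) : R) ^+ u0 i j *
     ('X_(mxvec_index i j) : R) ^+ (q * ((i \in W) && (mate_of g s i == j))))).
    apply: eq_bigr => i _; apply: eq_bigr => j _.
    by rewrite -exprD -termE -exE.
  rewrite (eq_bigr _ (fun i _ => big_split _ _ _ _ _)) big_split; congr (_ * _).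
  rewrite (big_matching gmono gW (fun i j => 'X_(mxvec_index i j) : R)).
  by apply: eq_bigr => i _; rewrite ps /genx gmono ps.
exists c0, U0, ex, g; split=> //; rewrite -qE /pf_sub /pfaffian expr_sum_additive //.
rewrite mulr_sumr {1}[f]mpolyE.
(* Each term of [f] is reached by exactly one normalized permutation, which makes the support the
   index set of the Pfaffian sum. *)
have pE : perm_eq (msupp f) [seq term s | s <- index_enum _ & pf_perm s].
  apply: uniq_perm => // [|v].
    rewrite map_inj_in_uniq ?filter_uniq ?index_enum_uniq // => s s'.
    rewrite !mem_filter => /andP[ps _] /andP[ps' _] E; apply: pf_perm_inj => //.
    exact: (term_of_inj gmono gW q0 e_all E).
  apply/idP/mapP => [vS|[s _ ->]]; last exact: term_mem.
  have [s ps <-] := term_of_surj gmono gW 0%MM e_inj e_mem e_all vS.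
  by exists s; rewrite // mem_filter ps mem_index_enum.
rewrite (perm_big _ pE) big_map big_filter; apply: eq_bigr => s ps.
rewrite coefE // XE // exprMn -exprM mulnC exprM (exprN1_additive q0 haddR).
rewrite -scalerAl mulrC -scalerA; congr (_ *: _).
by case: (odd_perm s); rewrite ?expr0 ?expr1 ?scale1r ?mul1r // scaleN1r mulN1r mulrN.
Qed.

End Translation.

Theorem theorem4p1 (K : closedFieldType) (p : nat) (hp : char_exp K p)
    (r m : nat) (hr : ~~ odd r) (hrm : (r <= m)%N) :
  (forall f : {mpoly K[m * m]}, upper_mpoly f -> f != 0 ->
     (forall A : 'M[K]_m, alt_skew A -> (\rank A <= r)%N -> eval_mx f A = 0) ->
     (dfact r.+1 <= nterms f)%N)
  /\
  (forall f : {mpoly K[m * m]}, upper_mpoly f -> nterms f = dfact r.+1 ->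
     (forall A : 'M[K]_m, alt_skew A -> \rank A = r -> eval_mx f A = 0) ->
     exists (c : K) (u : 'X_{1..(m * m)}) (e : nat) (g : 'I_((r./2).+1.*2) -> 'I_m),
       [/\ c != 0,
           {mono g : a b / (a < b)%N} &
           f = c *: 'X_[u] * (pf_sub K g) ^+ (p ^ e)]).
Proof.
have rE : (r./2 + r./2)%N = r by rewrite addnn even_halfK.
have dE : dfact r.+1 = dfact (r./2.*2.+1) by rewrite even_halfK.
rewrite dE; split=> f uf.
  move=> f0 hv; apply: (nterms_lower_bound (wf_mpoly uf)); first by rewrite msupp_eq0.
  move=> B; rewrite -eval_gram //; apply: hv; first exact: alt_skew_gram.
  by apply: leq_trans (rank_gram B) _; rewrite rE.
move=> szf hv; apply: extremal_form => // B; rewrite -eval_gram //.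
(* The hypothesis concerns rank exactly [r]. Gram matrices with [G B'] nonzero have this rank, and
   density extends the vanishing to every [B']. *)
pose G (B' : 'M[K]_(m, r./2 + r./2)) := \det ((pid_mx (r./2 + r./2) : 'M_(_, m)) *m B').
have lpG : linepoly G.
  apply: lp_det => i j; apply: eq_lp (_ : linepoly (fun B' : 'M[K]_(m, r./2 + r./2) =>
    \sum_k (pid_mx (r./2 + r./2) : 'M_(_, m)) i k * B' k j)) => [B'|]; first by rewrite mxE.
  by apply: lp_sum => k _; apply: lp_mul; [apply: lp_const | apply: lp_entry].
rewrite eval_gram //.
suff Z : forall B' : 'M[K]_(m, r./2 + r./2), True ->
    pe (@edge_exp m) (fun u => f@_u) (msupp f) set0 B' = 0 by apply: Z.
apply: (lp_zero (@linear_setT K _) (@lp_pe K m _ _ _ _ _ _) lpG).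
  by have [|B' hB'] := @generic_rank_exists K m r./2; rewrite ?rE //; exists B'.
move=> B' _ nz; rewrite -eval_gram //; apply: hv; first exact: alt_skew_gram.
by rewrite rank_gram_generic.
Qed.
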